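(* Let $\mathcal B\subseteq\mathbb N$ be infinite, let $S_1\subset S_2\subset\dots$ be a filtration of $\mathcal B$ by finite sets, and let $s_k,c_k,d_k$ be the associated integers. a) The translation by $(1,1,\dots)$ on $H/H_{\operatorname{int}(W)}\cong\varprojlim\mathbb Z/d_k\mathbb Z$ is the maximal equicontinuous factor of the dynamics $(X_\eta,\sigma)$. b) If $H_{\operatorname{int}(W)}=\{0\}$ (equivalently, $s_k=d_k$ for each $k\in\mathbb N$; equivalently, for each $b\in\mathcal B$ there is $n>0$ such that $b$ divides $c_n$), then the translation by $\Delta(1)$ on $H\cong\varprojlim\mathbb Z/s_k\mathbb Z$ is the maximal equicontinuous factor of the dynamics $(X_\eta,\sigma)$.
   Context: $\mathbb N=\{1,2,\dots\}$. For $A\subseteq\mathbb N$ let $\mathcal M_A=\bigcup_{a\in A}a\mathbb Z$, $\mathcal F_A=\mathbb Z\setminus\mathcal M_A$. $\Delta:\mathbb Z\to\prod_{b\in\mathcal B}\mathbb Z/b\mathbb Z$, $\Delta(n)=(n \bmod b)_{b\in\mathcal B}$; $H:=\overline{\Delta(\mathbb Z)}$ is a compact abelian group (product topology); the window is $W:=\{h\in H: h_b\neq 0\ \forall b\in\mathcal B\}$; $\operatorname{int}(W)$ is its interior in $H$. For $A\subseteq H$, $H_A:=\{h\in H:A+h=A\}$; $H_{\operatorname{int}(W)}$ is a closed subgroup of $H$. $\eta\in\{0,1\}^{\mathbb Z}$ is the indicator function of $\mathcal F_{\mathcal B}$, $\sigma$ is the left shift and $X_\eta=\overline{\{\sigma^n\eta:n\in\mathbb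 Z\}}$ (product topology). For finite $S\subset\mathcal B$: $\mathcal A_S:=\{\gcd(b,\operatorname{lcm}(S)):b\in\mathcal B\}$ (a finite set). A filtration of $\mathcal B$ by finite sets is an increasing sequence of finite subsets with union $\mathcal B$. Put $s_k:=\operatorname{lcm}(S_k)$; $c_l$ := the least $c\in\mathbb N$ with $c+\mathcal M_{\mathcal A_{S_l}}=\mathcal M_{\mathcal A_{S_l}}$; one has $c_l\mid c_{l+1}$, so for each $k$ the sequence $(\gcd(s_k,c_{k+j}))_j$ is eventually constant, and $d_k:=\lim_{j\to\infty}\gcd(s_k,c_{k+j})$. Then $s_k\mid s_{k+1}$, $d_k\mid d_{k+1}$, $d_k\mid s_k$; inverse limits are along canonical projections. The isomorphism $\varprojlim\mathbb Z/s_k\mathbb Z\cong H$ sends $(n_k+s_k\mathbb Z)_k$ to the $h\in H$ with $h_b=n_k\bmod b$ for all $b\in S_k$, $k\in\mathbb N$; composing its inverse with the map induced by the projections $\mathbb Z/s_k\mathbb Z\to\mathbb Z/d_k\mathbb Z$ gives a surjection $H\to\varprojlim\mathbb Z/d_k\mathbb Z$ with kernel $H_{\operatorname{int}(W)}$, hence the isomorphism in a), under which $\Delta(1)+H_{\operatorname{int}(W)}$ corresponds to $(1,1,\dots)$. *)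

(* Defs.v *)
From HB Require Import structures.
From mathcomp Require Import all_boot all_order all_algebra finmap.
From mathcomp Require Import all_classical topology pseudometric_normed_Zmodule tvs.

Set Implicit Arguments.
Unset Strict Implicit.
Unset Printing Implicit Defensive.

Import Order.TTheory GRing.Theory Num.Theory.
Local Open Scope classical_set_scope.
Local Open Scope ring_scope.

(* Z/nZ for n > 0, with the discrete topology. Unlike 'Z_n this is the trivial
   group when n = 1; for n = 0 it is also trivial, but only positive moduli are
   ever relevant. *)
Definition cyc (n : nat) : Type := 'I_n.-1.+1.
HB.instance Definition _ n := Finite.copy (cyc n) 'I_n.-1.+1.
HB.instance Definition _ n := GRing.Zmodule.copy (cyc n) 'I_n.-1.+1.
HB.instance Definition _ n := hasNbhs.Build (cyc n) principal_filter.
HB.instance Definition _ n := Discrete_ofNbhs.Build (cyc n) erefl.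
HB.instance Definition _ n := DiscreteUniform_ofNbhs.Build (cyc n).

(* z-th multiple of the class of 1, i.e. the class of z in Z/nZ. *)
Definition residue (n : nat) (z : int) : cyc n := (Zp1 : 'I_n.-1.+1) *~ z.

Lemma residueB n x y : residue n (x - y) = residue n x - residue n y.
Proof. exact: mulrzBr. Qed.

Definition cycprod (I : Type) (m : I -> nat) : Type :=
  prod_topology (fun i => cyc (m i)).

Section Cycprod.
Variables (I : Type) (m : I -> nat).

HB.instance Definition _ := Uniform.copy (cycprod m)
  (prod_topology (fun i => cyc (m i))).

Implicit Types x y z : cycprod m.
Let add x y : cycprod m := fun i => x i + y i.
Let opp x : cycprod m := fun i => - x i.
Let zero : cycprod m := fun i => 0.
Let addA : associative add.
Proof. by move=> x y z; apply: functional_extensionality_dep => i; exact: addrA. Qed.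
Let addC : commutative add.
Proof. by move=> x y; apply: functional_extensionality_dep => i; exact: addrC. Qed.
Let add0 : left_id zero add.
Proof. by move=> x; apply: functional_extensionality_dep => i; exact: add0r. Qed.
Let addN : left_inverse zero opp add.
Proof. by move=> x; apply: functional_extensionality_dep => i; exact: addNr. Qed.
HB.instance Definition _ :=
  GRing.isZmodule.Build (cycprod m) addA addC add0 addN.

Lemma cycprod_entourage (i : I) :
  entourage [set xy : cycprod m * cycprod m | xy.1 i = xy.2 i].
Proof.
pose U := [set xy : cycprod m * cycprod m | xy.1 i = xy.2 i].
have entU : @entourage (initial_topology (@proj _ (fun i => cyc (m i)) i)) U.
  exists [set xy : cyc (m i) * cyc (m i) | xy.1 = xy.2].
    by rewrite uniform_discrete => _ [x _ <-].
  by [].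
have pU : `[< @entourage (initial_topology (@proj _ (fun i => cyc (m i)) i)) U >].
  exact/asboolP.
exists U => //.
pose e : {p : {classic I} * set (cycprod m * cycprod m) |
  `[< @entourage (initial_topology (@proj _ (fun i => cyc (m i)) p.1)) p.2 >]}
  := exist _ (i : {classic I}, U) pU.
exists [fset e]%fset; first by move=> ? ?; rewrite inE.
rewrite eqEsubset; split => xy.
  by move=> /(_ e); apply; rewrite /= inE.
by move=> Uxy f /=; rewrite inE => /eqP ->.
Qed.

Lemma cycprod_filter (F : set_system (cycprod m * cycprod m)) : Filter F ->
  (forall i, F [set xy | xy.1 i = xy.2 i]) -> forall E, entourage E -> F E.
Proof.
move=> FF Fi E [B [D _ <-] DE]; apply: filterS DE _.
apply: filter_bigI => -[[i e] /= pe] _.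
have [V entV Ve] := asboolW pe.
apply: filterS (Fi i) => -[x y] /= xy; apply: Ve => /=.
move: entV; rewrite uniform_discrete; apply; exists (x i).
  by [].
by congr pair.
Qed.

Let sub_unif : unif_continuous (fun x : cycprod m * cycprod m => x.1 - x.2).
Proof.
apply: cycprod_filter => i.
have := prod_entP (cycprod_entourage i) (cycprod_entourage i).
apply: filterS => -[[x1 x2] [y1 y2]] /= [e1 e2].
by rewrite /GRing.add /GRing.opp /= /add /opp e1 e2.
Qed.
HB.instance Definition _ :=
  PreUniformNmodule_isUniformZmodule.Build (cycprod m) sub_unif.

Definition residues (n : int) : cycprod m := fun i => residue (m i) n.

Lemma residuesB n p : residues (n - p) = residues n - residues p.
Proof. by apply: functional_extensionality_dep => i; exact: residueB. Qed.
End Cycprod.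


Section Subgroup.
Variables (G : UniformZmodule.type) (P : zmodClosed G).

(* Subgroup P of G with the subspace topology and uniformity. *)
Definition zsub : Type := {x : G | x \in P}.
HB.instance Definition _ := SubChoice.copy zsub {x : G | x \in P}.
HB.instance Definition _ := [SubChoice_isSubZmodule of zsub by <:].
HB.instance Definition _ := Uniform.copy zsub (initial_topology (val : zsub -> G)).
HB.instance Definition _ := isPointed.Build zsub 0.

Let sub_unif : unif_continuous (fun x : zsub * zsub => x.1 - x.2).
Proof.
move=> E [V entV VE].
have [[A1 A2] /= [entA1 entA2] A12] := @sub_unif_continuous G _ entV.
have := @prod_entP zsub zsub ((fun xy => (val xy.1, val xy.2)) @^-1` A1)
  ((fun xy => (val xy.1, val xy.2)) @^-1` A2).
move=> /(_ (ex_intro2 _ _ _ entA1 (fun _ => id)) (ex_intro2 _ _ _ entA2 (fun _ => id))).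
apply: filterS => -[[x1 x2] [y1 y2]] /= [A1x A2x]; apply: VE => /=.
have [[[a b] [c d]] /= Vab [ea eb ec ed]] :=
  A12 ((val x1, val y1), (val x2, val y2)) (conj A1x A2x).
by move: Vab; rewrite ea eb ec ed.
Qed.
HB.instance Definition _ :=
  PreUniformNmodule_isUniformZmodule.Build zsub sub_unif.

Definition in_zsub (x : G) (Px : x \in P) : zsub := Sub x Px.
End Subgroup.

Lemma entourage_shift (G : UniformZmodule.type) (D : set (G * G)) :
  entourage D -> exists2 D' : set (G * G), entourage D' &
    forall a b t, D' (a, b) -> D (a + t, b + t).
Proof.
move=> entD.
have [[A1 A2] /= [entA1 entA2] A12] := @add_unif_continuous G _ entD.
exists A1 => // a b t A1ab.
have [[[x y] [z w]] /= Dxy [ex ey ez ew]] :=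
  A12 ((a, b), (t, t)) (conj A1ab (entourage_refl t entA2)).
by move: Dxy; rewrite ex ey ez ew.
Qed.

Section Quotient.
Variables (G : UniformZmodule.type) (P : zmodClosed G).

(* Quotient group G / P with the quotient topology; zquot_ent below is the
   quotient uniformity, shown to induce that topology. *)
Definition zquot : Type := quotient_topology (Quotient.quot P).
HB.instance Definition _ :=
  Topological.copy zquot (quotient_topology (Quotient.quot P)).
HB.instance Definition _ := GRing.isZmodule.Build zquot
  (@Quotient.addqA G P) (@Quotient.addqC G P)
  (@Quotient.add0q G P) (@Quotient.addNq G P).
HB.instance Definition _ := isPointed.Build zquot 0.

Definition zpi : G -> zquot := \pi_(Quotient.quot P)%qT.

Lemma zpi_surj (q : zquot) : exists x, zpi x = q.
Proof. by exists (repr (q : Quotient.quot P)); exact: reprK. Qed.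

Lemma zpi_eq x y : (zpi x = zpi y) <-> x - y \in P.
Proof.
rewrite Quotient.idealrBE; split=> [E|/eqP E]; last exact: E.
by apply/eqP; exact: E.
Qed.

Definition zquot_ent : set_system (zquot * zquot) :=
  [set E | entourage [set xy : G * G | E (zpi xy.1, zpi xy.2)]].

Let ent_filter : Filter zquot_ent.
Proof.
split; first exact: filterT.
- by move=> E F entE entF; exact: filterI entE entF.
- by move=> E F EF; apply: filterS => xy /=; exact: EF.
Qed.

Let ent_refl E : zquot_ent E -> diagonal `<=` E.
Proof.
move=> entE [q r] /diagonalP ->; have [x <-] := zpi_surj r.
exact: (entourage_refl x entE).
Qed.

Let ent_inv E : zquot_ent E -> zquot_ent (E^-1)%relation.
Proof. by move=> entE; exact: (entourage_inv entE). Qed.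

Let ent_split E : zquot_ent E ->
  exists2 F, zquot_ent F & (F \; F `<=` E)%relation.
Proof.
move=> entE; have [D entD DDE] := entourage_split_ex entE.
have [D' entD' D'D] := entourage_shift entD.
exists [set qr | exists ab : G * G, D' ab /\ qr = (zpi ab.1, zpi ab.2)].
  by apply: filterS entD' => ab D'ab; exists ab.
move=> [q r] /= [p [[a b] /= [Dab [-> ->]]] [[c d] /= [Dcd [ebc ->]]]].
move=> /=.
have Pbc : b - c \in P by apply/zpi_eq.
have -> : zpi d = zpi (d + (b - c)).
  by apply/zpi_eq; rewrite opprD addNKr rpredN.
apply: (DDE (a, d + (b - c))); exists b.
  by have := D'D a b 0 Dab; rewrite !addr0.
by have := D'D c d (b - c) Dcd; rewrite addrC subrK.
Qed.

Let ent_nbhs : nbhs = nbhs_ zquot_ent.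
Proof.
rewrite predeq2E => q U; split.
  rewrite nbhsE => -[O [oO Oq] OU].
  have [x xq] := zpi_surj q.
  have : nbhs x (zpi @^-1` O).
    by apply: open_nbhs_nbhs; split => //=; rewrite xq.
  move=> /nbhsP[D entD DO].
  have [D' entD' D'D] := entourage_shift entD.
  exists [set qr | exists ab : G * G, D' ab /\ qr = (zpi ab.1, zpi ab.2)].
    by apply: filterS entD' => ab D'ab; exists ab.
  move=> r /xsectionP[[a b] /= [D'ab [qa ->]]]; apply: OU.
  have Pxa : x - a \in P by apply/zpi_eq; rewrite xq.
  have -> : zpi b = zpi (b + (x - a)).
    by apply/zpi_eq; rewrite opprD addNKr rpredN.
  apply: DO; apply/xsectionP.
  by have := D'D a b (x - a) D'ab; rewrite addrC subrK.
move=> [E entE EU].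
rewrite nbhsE; exists [set r | exists2 F, zquot_ent F & xsection F r `<=` U].
  split; last by exists E.
  rewrite /open /= /quotient_open openE => x /= [F entF FU].
  have [F' entF' FF'] := ent_split entF.
  apply/nbhsP; exists [set xy : G * G | F' (zpi xy.1, zpi xy.2)] => //.
  move=> y /xsectionP /= F'xy; exists F' => // r /xsectionP F'yr.
  by apply/FU/xsectionP/FF'; exists (zpi y).
by move=> r [F entF]; apply; apply/xsectionP/(ent_refl entF)/diagonalP.
Qed.

HB.instance Definition _ := @Nbhs_isUniform.Build zquot
  zquot_ent ent_filter ent_refl ent_inv ent_split ent_nbhs.
End Quotient.

Section Stabilizer.
Variable G : zmodType.

(* { h | A + h = A } *)
Definition stab (A : set G) : set G := [set h | [set a + h | a in A] = A].
Definition stab_pred (A : set G) : {pred G} := fun h => `[< stab A h >].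

Let stab_closed A : zmod_closed (stab_pred A).
Proof.
have stabP h : h \in stab_pred A <-> forall a, A (a + h) <-> A a.
  split.
    move=> /asboolP Ah a; split=> [|Aa]; last by rewrite -Ah; exists a.
    by rewrite -{1}Ah => -[b Ab /addIr <-].
  move=> Ah; apply/asboolP; rewrite /stab /= eqEsubset; split=> [_ [a Aa <-]|a Aa].
    exact/Ah.
  by exists (a - h); [apply/Ah; rewrite subrK|rewrite subrK].
split; first by apply/stabP => a; rewrite addr0.
move=> g h /stabP Ag /stabP Ah; apply/stabP => a.
by rewrite addrA -(Ah (a + g - h)) subrK.
Qed.
HB.instance Definition _ A :=
  GRing.isZmodClosed.Build G (stab_pred A) (stab_closed A).
End Stabilizer.

Section InverseLimit.
Variable s : nat -> nat.

(* Inverse limit of the Z/s_kZ: (x k.+1, x k) lies on the graph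
   { (n + s_{k+1}Z, n + s_kZ) | n in Z } of the canonical projection. When s_k
   divides s_{k+1} this says exactly that x k.+1 is mapped to x k; written in
   this way, it defines a subgroup whatever the sequence s. *)
Definition invlim_pred : {pred cycprod s} := fun x =>
  `[< forall k, exists n : int,
        x k = residue (s k) n /\ x k.+1 = residue (s k.+1) n >].

Let invlim_closed : zmod_closed invlim_pred.
Proof.
split; first by apply/asboolP => k; exists 0; rewrite /residue !mulr0z.
move=> x y /asboolP xP /asboolP yP; apply/asboolP => k.
have [[n [n1 n2]] [p [p1 p2]]] := (xP k, yP k).
by exists (n - p); rewrite !residueB -n1 -n2 -p1 -p2.
Qed.
HB.instance Definition _ :=
  GRing.isZmodClosed.Build (cycprod s) invlim_pred invlim_closed.

Definition invlim := zsub invlim_pred.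

Lemma invlim_int_subproof (n : int) :
  residues s n \in invlim_pred.
Proof. by apply/asboolP => k; exists n. Qed.
(* The constant thread (n, n, ...). *)
Definition invlim_int (n : int) : invlim := in_zsub (invlim_int_subproof n).
End InverseLimit.

Section OdometerGroup.
Variable B : set nat.

Definition Delta (n : int) : cycprod (fun b : B => val b) := residues _ n.

Definition H_pred : {pred cycprod (fun b : B => val b)} :=
  fun h => h \in closure (range Delta).

Let H_closed : zmod_closed H_pred.
Proof.
split.
  by apply/mem_set/subset_closure; exists 0.
move=> x y /set_mem xP /set_mem yP; apply/mem_set => U Uxy.
move/nbhsP: Uxy => [E entE EU].
have [[A1 A2] /= [entA1 entA2] A12] :=
  @sub_unif_continuous (cycprod (fun b : B => val b)) _ entE.
have [_ [[n _ <-] /xsectionP A1n]] := xP _ (nbhs_entourage x entA1).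
have [_ [[p _ <-] /xsectionP A2p]] := yP _ (nbhs_entourage y entA2).
exists (Delta n - Delta p); split; last first.
  have [[[a b] [c d]] /= Eab [ea eb ec ed]] :=
    A12 ((x, Delta n), (y, Delta p)) (conj A1n A2p).
  by apply/EU/xsectionP; move: Eab; rewrite ea eb ec ed.
by exists (n - p) => //; exact: residuesB.
Qed.
HB.instance Definition _ := GRing.isZmodClosed.Build _ H_pred H_closed.

(* The closure of Delta(Z) in the product of the Z/bZ, b in B. *)
Definition H := zsub H_pred.

Lemma Delta_H_subproof n : Delta n \in H_pred.
Proof. by apply/mem_set/subset_closure; exists n. Qed.
Definition Delta_H (n : int) : H := in_zsub (Delta_H_subproof n).

Definition window : set H := [set h | forall b, val h b != 0].
Definition H_int : set H := @stab H window°.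
Definition H_quot := zquot (@stab_pred H window°).
End OdometerGroup.
Arguments window : clear implicits.
Arguments H_int : clear implicits.

Definition multiples (A : set nat) : set int :=
  \bigcup_(a in A) [set z : int | (a%:Z %| z)%Z].
Definition free_set (A : set nat) : set int := ~` multiples A.

(* sigma^n, where sigma is the left shift. *)
Definition translate (n : int) (x : {ptws int -> bool}) : {ptws int -> bool} :=
  fun k => x (k + n).

Definition orbit_closure (x : {ptws int -> bool}) : set {ptws int -> bool} :=
  closure (range (fun n => translate n x)).

Lemma translate_continuous n : continuous (translate n).
Proof.
move=> x; apply/cvg_sup => i U [_ [[W oW <-] /= Wx] /filterS]; apply.
exact: (@proj_continuous int (fun=> bool) (i + n) x _ (open_nbhs_nbhs (conj oW Wx))).
Qed.

Lemma orbit_closure_translate x y :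
  orbit_closure x y -> orbit_closure x (translate 1 y).
Proof.
move=> xy U /translate_continuous /xy[_ [[n _ <-] /= Un]].
exists (translate 1 (translate n x)); split => //; exists (n + 1) => //.
by apply: functional_extensionality_dep => k; rewrite /translate addrAC addrA addrAC.
Qed.

Definition subshift (x : {ptws int -> bool}) : Type := set_type (orbit_closure x).
HB.instance Definition _ x :=
  Topological.copy (subshift x) (set_type (orbit_closure x)).

Definition left_shift (x : {ptws int -> bool}) (y : subshift x) : subshift x :=
  exist _ (translate 1 (val y))
    (mem_set (orbit_closure_translate (set_mem (valP y)))).

Definition eta_free (B : set nat) : {ptws int -> bool} := fun n => n \in free_set B.

Section Arithmetic.
Variables (B : set nat) (S : nat -> {fset nat}).

Definition lcm_fset (A : {fset nat}) : nat := \big[lcmn/1%N]_(a <- A) a.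

(* For A a finite subset of B, the set { gcd(b, lcm A) | b in B }. *)
Definition gcd_set (A : {fset nat}) : set nat :=
  [set gcdn b (lcm_fset A) | b in B].

Definition period (M : set int) (c : nat) : Prop := [set c%:Z + z | z in M] = M.

Definition least_period (M : set int) : nat :=
  [get c | [/\ (0 < c)%N, period M c &
              forall c', (0 < c')%N -> period M c' -> (c <= c')%N]].

(* The filtration is indexed from 0, so s_ k, c_ k, d_ k stand for the usual
   s_{k+1}, c_{k+1}, d_{k+1}. *)
Definition s_ (k : nat) : nat := lcm_fset (S k).
Definition c_ (l : nat) : nat := least_period (multiples (gcd_set (S l))).
Definition d_ (k : nat) : nat := lim (gcdn (s_ k) (c_ (k + j)%N) @[j --> \oo]).
End Arithmetic.

Section Dynamics.

Definition homeomorphism (X Y : topologicalType) (f : X -> Y) : Prop :=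
  continuous f /\
  exists g : Y -> X, [/\ continuous g, cancel f g & cancel g f].

Definition compact_system (X : topologicalType) (T : X -> X) : Prop :=
  [/\ compact [set: X], hausdorff_space X & homeomorphism T].

(* For a bijection T, the set of all T^n with n in Z. *)
Definition int_powers (X : Type) (T : X -> X) : set (X -> X) :=
  [set f | exists n : nat, f = iter n T \/
             (cancel f (iter n T) /\ cancel (iter n T) f)].

Definition equicontinuous_system (Y : puniformType) (R : Y -> Y) : Prop :=
  compact_system R /\ equicontinuous (int_powers R) id.

Definition factor_map (X Y : topologicalType) (T : X -> X) (R : Y -> Y)
    (p : X -> Y) : Prop :=
  [/\ continuous p, (forall y, exists x, p x = y) & forall x, p (T x) = R (p x)].

(* (Y, R) is the maximal equicontinuous factor of (X, T): it is an
   equicontinuous factor, via some p, and every equicontinuous factor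
   q : X -> Z factors through p. As Y and Z are compact Hausdorff, their
   uniformities are the unique ones compatible with their topologies. *)
Definition is_MEF (X : topologicalType) (T : X -> X)
    (Y : puniformType) (R : Y -> Y) : Prop :=
  equicontinuous_system R /\
  exists p : X -> Y, factor_map T R p /\
    forall (Z : puniformType) (Q : Z -> Z) (q : X -> Z),
      equicontinuous_system Q -> factor_map T Q q ->
      exists r : Y -> Z, factor_map R Q r /\ forall x, q x = r (p x).

Definition topological_group_iso (G1 G2 : PreTopologicalZmodule.type)
    (f : G1 -> G2) : Prop :=
  zmod_morphism f /\ homeomorphism f.
End Dynamics.

(* Main.v *)
(* Write P_l (core l) for the set of n such that n + s_l Z is B-free; it is the
   complement of the multiples of A_{S_l}, so c_l is its least period. Every
   multiple of b in B is a multiple of b periodically, hence finitely many b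
   witness all classes modulo s_l outside P_l. It follows that a point x of
   X_eta determines, locally constantly, the class modulo c_l of the shifts
   approximating it. As c_l | d_l and each d_k divides some c_l, this is a
   factor map onto lim Z/d_k.
   If x and y have the same image, all their undecided positions in a finite
   window can be turned into zeros of both x and y by passing to a smaller
   progression of shifts, so x and y are proximal; an equicontinuous factor
   cannot separate proximal points, whence maximality.
   In H, the interior of W is the union of the cylinders h = n mod s_k with n
   in P_k, so h stabilizes it iff h = 0 mod c_k for all k, iff h = 0 mod d_k
   for all k. *)
Require Import Defs.
From HB Require Import structures.
From mathcomp Require Import all_boot all_order all_algebra finmap.
From mathcomp Require Import ring zify.
From mathcomp Require Import all_classical topology pseudometric_normed_Zmodule tvs.

Set Implicit Arguments.
Unset Strict Implicit.
Unset Printing Implicit Defensive.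

Import Order.TTheory GRing.Theory Num.Theory.
Local Open Scope classical_set_scope.
Local Open Scope ring_scope.

(** * Compactness and continuity for subgroups of products of finite cyclic groups *)

(** A cluster point of the image filter has the form [f s]; as the open sets of the initial topology
    are preimages under [f], this [s] is a cluster point of the filter itself. *)
Lemma initial_compact (S : choiceType) (T : topologicalType) (f : S -> T) :
  compact (range f) -> compact [set: initial_topology f].
Proof.
move=> cA F PF _.
have : (f @ F) (range f) by apply: (@filterS _ F _ setT) => [x _|]; [exists x|exact: filterT].
move=> /cA [_ [[s _ <-]] fFs]; exists s; split => // A B FA.
rewrite nbhsE => -[O [[V oV <-] Vs] VB].
have [| _ [[x Ax <-] Vx]] := fFs (f @` A) V _ (open_nbhs_nbhs (conj oV Vs)).
  by apply: (@filterS _ F _ A) => // x Ax; exists x.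
by exists x; split => //; exact: VB.
Qed.

Lemma zsub_continuous (I : Type) (X : topologicalType) (m : I -> nat) (P : zmodClosed (cycprod m))
    (f : X -> zsub P) :
  (forall i, continuous (fun x => val (f x) i)) -> continuous f.
Proof.
move=> cf; apply: continuous_comp_initial => x.
by apply/cvg_sup => i; apply: continuous_comp_initial => {}x; exact: cf.
Qed.

Lemma zsub_coord_continuous (I : Type) (m : I -> nat) (P : zmodClosed (cycprod m)) i :
  continuous (fun x : zsub P => val x i).
Proof.
move=> x; apply: (@continuous_comp _ _ _ (val : zsub P -> cycprod m) (fun y => y i)).
  exact: initial_continuous.
exact: (@proj_continuous {classic I} (fun i => cyc (m i)) i).
Qed.

Lemma zsub_hausdorff (I : Type) (m : I -> nat) (P : zmodClosed (cycprod m)) :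
  hausdorff_space (zsub P).
Proof.
move=> x y xy; apply/val_inj/functional_extensionality_dep => i.
apply: contrapT => xyi.
have cx (z : zsub P) : nbhs z [set z' : zsub P | val z' i = val z i].
  by apply: (@zsub_coord_continuous _ _ P i z [set c | c = val z i]); rewrite /nbhs/=.
have [z [/= -> ]] := xy _ _ (cx x) (cx y).
exact: xyi.
Qed.

Lemma zsub_compact (I : Type) (m : I -> nat) (P : zmodClosed (cycprod m)) :
  closed [set x : cycprod m | x \in P] -> compact [set: zsub P].
Proof.
move=> cP; apply: initial_compact.
have -> : range (val : zsub P -> cycprod m) = [set x : cycprod m | x \in P].
  rewrite eqEsubset; split => [_ [x _ <-]|x Px]; first exact: valP.
  by exists (Sub x Px).
apply: (subclosed_compact cP _ (@subsetT _ _)).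
have fin i : finite_set [set: cyc (m i)] by exact: (@finite_finset (cyc (m i))).
have := @tychonoff {classic I} (fun i => cyc (m i)) (fun=> setT)
  (fun i => finite_compact (fin i)).
by congr compact; rewrite eqEsubset.
Qed.

(** The preimage of a closed set under [r] is the image under [p] of its preimage under [q], hence
    compact, hence closed. *)
Lemma factor_continuous (X Y Z : topologicalType) (p : X -> Y) (q : X -> Z) (r : Y -> Z) :
    compact [set: X] -> hausdorff_space Y -> continuous p ->
    (forall y, exists x, p x = y) -> continuous q -> (forall x, q x = r (p x)) ->
  continuous r.
Proof.
move=> cX hY cp sp cq qr; apply/continuous_closedP => A cA.
have -> : r @^-1` A = p @` (q @^-1` A).
  rewrite eqEsubset; split => [y /= Ay|_ [x /= Ax <-] /=]; last by rewrite -qr.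
  by have [x xy] := sp y; exists x => //=; rewrite qr xy.
apply: compact_closed => //; apply: continuous_compact.
  exact: continuous_subspaceT.
by apply: subclosed_compact cX _ => //; move/continuous_closedP: cq; exact.
Qed.

Lemma compact_homeomorphism (X Y : topologicalType) (f : X -> Y) :
    compact [set: X] -> hausdorff_space Y -> continuous f -> injective f ->
    (forall y, exists x, f x = y) ->
  homeomorphism f.
Proof.
move=> cX hY cf injf surjf; split => //.
have [g fg] := choice surjf.
exists g; split => [|x|]; [|by apply: injf; rewrite fg|exact: fg].
apply: (factor_continuous cX hY cf surjf (q := id)) => x; first exact: cvg_id.
by apply: injf; rewrite fg.
Qed.

(** * Translations, equicontinuity and equicontinuous factors *)

(** One entourage serves all translations at once. The property is isolated so that it can be
    established for [zquot], whose declared structure does not include uniformly continuous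
    operations. *)
Definition uniform_translations (G : PreUniformZmodule.type) : Prop :=
  forall D : set (G * G), entourage D -> exists2 D' : set (G * G), entourage D' &
    forall a b t, D' (a, b) -> D (a + t, b + t).

Lemma homeomorphism_hausdorff (X Y : topologicalType) (f : X -> Y) :
  homeomorphism f -> hausdorff_space Y -> hausdorff_space X.
Proof.
move=> [cf [g [_ fK _]]] hY x y xy; apply: (can_inj fK); apply: hY => V W fxV fyW.
by have [z [Vz Wz]] := xy _ _ (cf x V fxV) (cf y W fyW); exists (f z).
Qed.

Lemma translation_homeomorphism (G : PreUniformZmodule.type) (g : G) :
  uniform_translations G -> homeomorphism (fun x : G => x + g).
Proof.
move=> uG; have c (t : G) : continuous (fun x : G => x + t).
  move=> x U /nbhsP[E entE EU]; have [D entD DE] := uG _ entE.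
  apply/nbhsP; exists D => // y /xsectionP Dxy; apply/EU/xsectionP; exact: DE.
by split => //; exists (fun x => x - g); split => // x; rewrite ?addrK ?subrK.
Qed.

Lemma int_powers_translation (G : zmodType) (g : G) (f : G -> G) :
  int_powers (fun x => x + g) f -> exists t, f = (fun x => x + t).
Proof.
have it n x : iter n (fun x => x + g) x = x + g *+ n.
  by elim: n => [|n IH] /=; rewrite ?mulr0n ?addr0// IH mulrSr addrA.
move=> [n [->|[fi _]]].
  by exists (g *+ n); apply/funext => x; exact: it.
by exists (- (g *+ n)); apply/funext => x; rewrite -{2}[x]fi it addrK.
Qed.

Lemma translation_equicontinuous (G : PreUniformZmodule.type) (g : G) (E : set (G * G)) x :
  uniform_translations G -> entourage E ->
  \forall y \near x, forall f, int_powers (fun x => x + g) f -> E (f x, f y).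
Proof.
move=> uG entE; have [D entD DE] := uG _ entE.
apply/nbhsP; exists D => // y /xsectionP Dxy f /int_powers_translation[t ->].
exact: DE.
Qed.

Lemma zpiD (G : UniformZmodule.type) (P : zmodClosed G) x y :
  zpi P (x + y) = zpi P x + zpi P y.
Proof. by rewrite /zpi !piE. Qed.

Lemma zquot_uniform_translations (G : UniformZmodule.type) (P : zmodClosed G) :
  uniform_translations (zquot P).
Proof.
move=> D entD; have [D' entD' D'D] := entourage_shift (entD : zquot_ent D).
exists [set qr | exists ab : G * G, D' ab /\ qr = (zpi P ab.1, zpi P ab.2)].
  by apply: (filterS _ entD') => ab D'ab; exists ab.
move=> q r t [[a b] [/= D'ab [-> ->]]]; have [u <-] := zpi_surj t.
by have := D'D a b u D'ab; rewrite /= !zpiD.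
Qed.

(** Equicontinuity of [R'] is a hypothesis because it refers to the uniformity of [Y'], whereas [f]
    is only a homeomorphism. *)
Lemma is_MEF_conjugate (X : topologicalType) (T : X -> X) (Y Y' : puniformType)
    (R : Y -> Y) (R' : Y' -> Y') (f : Y' -> Y) :
    is_MEF T R -> equicontinuous_system R' -> homeomorphism f ->
    (forall y, f (R' y) = R (f y)) ->
  is_MEF T R'.
Proof.
move=> [_ [p [[cp sp pT] maxp]]] eR' [cf [g [cg fK gK]]] fR; split => //.
have gR y : g (R y) = R' (g y) by rewrite -[y in LHS]gK -fR fK.
exists (g \o p); split.
  split => [x|y|x] /=; last by rewrite pT gR.
    by apply: continuous_comp; [exact: cp|exact: cg].
  by have [x xy] := sp (f y); exists x; rewrite /= xy fK.
move=> Z Q q eQ fq; have [r [[cr sr rR] rp]] := maxp Z Q q eQ fq.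
exists (r \o f); split => [|x]; last by rewrite /= gK.
split => [y|z|y] /=; last by rewrite fR rR.
  by apply: continuous_comp; [exact: cf|exact: cr].
by have [y yz] := sr z; exists (g y); rewrite /= gK.
Qed.

(** Along [U] the images of both orbits come close to [q w]. Equicontinuity at [q w] also controls
    the negative powers of [Q], and applying the power [- m n] brings the two images back to [q x]
    and [q y], which are therefore arbitrarily close. *)
Lemma proximal_equicontinuous (X : topologicalType) (T : X -> X) (Z : puniformType)
    (Q : Z -> Z) (q : X -> Z) (U : set_system nat) (m : nat -> nat) (x y w : X) :
    ProperFilter U ->
    iter (m n) T x @[n --> U] --> w -> iter (m n) T y @[n --> U] --> w ->
    equicontinuous_system Q -> factor_map T Q q ->
  q x = q y.
Proof.
move=> PU xw yw [[_ hZ [cQ [Q' [cQ' QK Q'K]]]] eQ] [cq _ qT].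
have qiter n z : q (iter n T z) = iter n Q (q z).
  by elim: n => //= n IH; rewrite qT IH.
have iterK n : cancel (iter n Q') (iter n Q) /\ cancel (iter n Q) (iter n Q').
  elim: n => [|n [IH1 IH2]]; first by split => ?.
  split => z; first by rewrite iterSr iterS Q'K IH1.
  by rewrite iterSr iterS QK IH2.
have near_w v C : iter (m n) T v @[n --> U] --> w -> nbhs (q w) C ->
    U [set n | C (q (iter (m n) T v))].
  by move=> vw /cq; exact: vw.
apply: hZ => A B /nbhsP[E entE EA] /nbhs_singleton Bqy.
exists (q y); split => //; apply/EA/xsectionP.
have [D entD DE] := entourage_split_ex entE.
have entDD : entourage (D `&` D^-1)%relation by apply: filterI => //; exact: entourage_inv.
have Dw := eQ (q w) _ entDD.
have [n [Dx Dy]] := filter_ex (filterI (near_w x _ xw Dw) (near_w y _ yw Dw)).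
have Q'm : int_powers Q (iter (m n) Q') by exists (m n); right; have [? ?] := iterK (m n).
move: (Dx _ Q'm) (Dy _ Q'm) => /=; rewrite !qiter !(iterK (m n)).2 => -[_ Dx'] [Dy' _].
by apply: DE; exists (iter (m n) Q' (q w)).
Qed.

(** * Residues, divisibility and least common multiples *)

Lemma residue0P n z : (0 < n)%N -> residue n z = 0 <-> (n%:Z %| z)%Z.
Proof.
move=> n0; have nE := prednK n0.
have nat0 k : (Zp1 : 'I_n.-1.+1) *+ k = 0 <-> (n %| k)%N.
  rewrite Zp_mulrn; split=> [/(congr1 val)|nk].
    by rewrite /= modnMml mul1n nE => /eqP.
  by apply/val_inj; rewrite /= modnMml mul1n nE; apply/eqP.
rewrite dvdzE; case: z => k /=; first exact: nat0.
rewrite -nat0 -[residue _ _]/(- ((Zp1 : 'I_n.-1.+1) *+ k.+1)).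
by split=> [/eqP|E]; [rewrite oppr_eq0 => /eqP|apply/eqP; rewrite oppr_eq0; apply/eqP].
Qed.

Lemma residueP n x y : (0 < n)%N -> residue n x = residue n y <-> (n%:Z %| x - y)%Z.
Proof.
by move=> n0; rewrite -residue0P // residueB; split=> [->|/subr0_eq //]; rewrite subrr.
Qed.

Lemma residueD n x y : residue n (x + y) = residue n x + residue n y.
Proof. exact: mulrzDr. Qed.

Lemma residue_nat n (x : cyc n) : residue n (x : nat)%:Z = x.
Proof.
rewrite /residue -[LHS]/((Zp1 : 'I_n.-1.+1) *+ (x : nat)) Zp_mulrn.
by apply/val_inj; rewrite /= modnMml mul1n modn_small.
Qed.

Lemma residue_residue m n z : (0 < m)%N -> (0 < n)%N -> (m %| n)%N ->
  residue m (residue n z : nat)%:Z = residue m z.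
Proof.
move=> m0 n0 mn; apply/residueP => //; apply: (@dvdz_trans n%:Z) => //.
by apply/residueP => //; exact: residue_nat.
Qed.

(** Bezout's identity provides the shift [j]. With [s] equal to some [s_k], this links the finite
    set [gcd_set] to whole residue classes. *)
Lemma dvdz_shift (b s : nat) (n : int) :
  ((gcdn b s)%:Z %| n)%Z <-> exists j : int, (b%:Z %| n + s%:Z * j)%Z.
Proof.
split=> [/dvdzP[w ->]|[j]].
  have [u [v uv]] := Bezoutz b s; exists (- (w * v)).
  have -> : (gcdn b s)%:Z = u * b%:Z + v * s%:Z by rewrite uv.
  by apply/dvdzP; exists (w * u); ring.
have gs : ((gcdn b s)%:Z %| s%:Z * j)%Z by apply: dvdz_mulr; rewrite dvdzE dvdn_gcdr.
move=> bn; rewrite -[n](addrK (s%:Z * j)); apply: rpredB => //.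
by apply: dvdz_trans bn; rewrite dvdzE dvdn_gcdl.
Qed.

Lemma dvdn_lcm_fset (A : {fset nat}) b : b \in A -> (b %| lcm_fset A)%N.
Proof. by move=> bA; rewrite /lcm_fset (big_rem b) //= dvdn_lcml. Qed.

Lemma lcm_fset_dvdn (A : {fset nat}) n :
  (forall b, b \in A -> (b %| n)%N) -> (lcm_fset A %| n)%N.
Proof.
move=> An; rewrite /lcm_fset big_seq.
apply: (big_ind (fun m => m %| n)%N) => [||b]; [exact: dvd1n| |exact: An].
by move=> x y xn yn; rewrite dvdn_lcm xn.
Qed.

Lemma lcm_fset_gt0 (A : {fset nat}) : (forall b, b \in A -> (0 < b)%N) -> (0 < lcm_fset A)%N.
Proof.
move=> A0; rewrite /lcm_fset big_seq.
by apply: (big_ind (fun m => 0 < m)%N) => [||b]; [|move=> x y x0 y0; rewrite lcmn_gt0 x0|exact: A0].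
Qed.

(** * Limits along ultrafilters and inverse limits *)

(** The image of an ultrafilter is an ultrafilter. Such limits replace the extraction of convergent
    subsequences below. *)
Lemma ultra_cvg (X : topologicalType) (U : set_system nat) (u : nat -> X) :
  UltraFilter U -> compact [set: X] -> exists x : X, u n @[n --> U] --> x.
Proof.
move=> UU cX; have PU : ProperFilter U by exact: ultra_proper.
have PuU : ProperFilter (u @ U) by exact: fmap_proper_filter.
have uU : UltraFilter (u @ U).
  split => // G PG UG; rewrite eqEsubset; split => // A GA.
  have [//|UnA] := in_ultra_setVsetC (u @^-1` A) UU.
  by have /filter_ex[? []] : G (A `&` ~` A) by apply: filterI => //; exact: UG.
by move: cX; rewrite compact_ultra => /(_ _ uU filterT)[x [_ ux]]; exists x.
Qed.

(** Under divisibility, the common representatives in [invlim_pred] turn into compatibility with the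
    canonical projections. *)
Lemma invlim_coord (s : nat -> nat) (s_gt0 : forall k, (0 < s k)%N)
    (s_dvd : forall k, (s k %| s k.+1)%N) (x : invlim s) k l :
  (k <= l)%N -> residue (s k) (val x l : nat)%:Z = val x k.
Proof.
move=> /subnK <-; elim: (l - k)%N => [|j IH]; first exact: residue_nat.
have dvd : (s k %| s (j + k))%N.
  by elim: j {IH} => // j IH; apply: dvdn_trans IH (s_dvd _).
rewrite -IH; have /asboolP/(_ (j + k)%N)[n [-> ->]] := valP x.
rewrite !residue_residue //; exact: dvdn_trans dvd (s_dvd _).
Qed.

Lemma zsub_cvg_coord (I : Type) (m : I -> nat) (P : zmodClosed (cycprod m))
    (U : set_system nat) (u : nat -> zsub P) (x : zsub P) :
  u n @[n --> U] --> x -> forall i, U [set n | val (u n) i = val x i].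
Proof.
move=> ux i; apply: (ux [set z | val z i = val x i]).
by apply: (@zsub_coord_continuous _ _ P i x [set c | c = val x i]); rewrite /nbhs/=.
Qed.

(** The constant threads are dense: choose [u n] above the constant thread of a representative of
    [y] at level [n]. Coordinate [k] of that thread is already right once [n >= k], so any limit of
    [u] is mapped to [y]. *)
Lemma invlim_surjective (s : nat -> nat) (X : topologicalType) (f : X -> invlim s) :
    (forall k, (0 < s k)%N) -> (forall k, (s k %| s k.+1)%N) ->
    compact [set: X] -> continuous f -> (forall n, exists x, f x = invlim_int s n) ->
  forall y, exists x, f x = y.
Proof.
move=> s_gt0 s_dvd cX cf fZ y.
have [u uP] := choice (fun k => fZ (val y k : nat)%:Z).
have [U [UU ooU]] := @ultraFilterLemma nat \oo _.
have PU : ProperFilter U by exact: ultra_proper.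
have [x ux] := ultra_cvg u UU cX; exists x.
apply/val_inj/functional_extensionality_dep => k.
have fux : f (u n) @[n --> U] --> f x by apply: (cvg_comp _ f ux); exact: cf.
have kU : U [set n | (k <= n)%N] by apply: ooU; exists k.
have [n [/= <- kn]] := filter_ex (filterI (zsub_cvg_coord fux k) kU).
by rewrite uP; exact: invlim_coord.
Qed.

Lemma invlim_compact (s : nat -> nat) : (forall k, (0 < s k)%N) -> compact [set: invlim s].
Proof.
move=> s_gt0; apply: zsub_compact => x xP; apply/asboolP => k.
have coord i : nbhs x [set y : cycprod s | y i = x i].
  apply: (@proj_continuous nat (fun i => cyc (s i)) i x [set c | c = x i]).
  by rewrite /nbhs/=.
have [y [/asboolP/(_ k) yP [/= <- <-]]] := xP _ (filterI (coord k) (coord k.+1)).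
exact: yP.
Qed.

(** * Least periods and stabilizers *)

(** The periods of [M] form a subgroup of the integers, generated by its least positive element. The
    period [s] makes this subgroup nonzero, so that [least_period] is not a default value. *)
Lemma least_periodP (M : set int) (s : nat) : (0 < s)%N ->
    (forall n, M (n + s%:Z) <-> M n) ->
  (0 < least_period M)%N /\
  forall z, (forall n, M (n + z) <-> M n) <-> ((least_period M)%:Z %| z)%Z.
Proof.
move=> s0 Ms.
have perP (c : nat) : period M c <-> forall n, M (n + c%:Z) <-> M n.
  rewrite /period; split=> [E n|E].
    split=> [|Mn]; last by rewrite -E; exists n; rewrite // addrC.
    by rewrite -{1}E => -[m Mm]; rewrite addrC => /addIr <-.
  rewrite eqEsubset; split=> [_ [m /E ? <-]|n Mn]; first by rewrite addrC.
  by exists (n - c%:Z); [apply/E; rewrite subrK|rewrite addrC subrK].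
pose L (c : nat) := (0 < c)%N && `[< period M c >].
have exL : exists c, L c by exists s; rewrite /L s0; apply/asboolP/perP.
have [c /andP[c0 /asboolP cP] cmin] := ex_minnP exL.
have : [/\ (0 < least_period M)%N, period M (least_period M) &
  forall c', (0 < c')%N -> period M c' -> (least_period M <= c')%N].
  apply: (getPex (P := [set c | [/\ (0 < c)%N, period M c & _ ]])).
  exists c; split => // c' c'0 /asboolP c'P; apply: cmin; exact/andP.
move: (least_period M) => {c c0 cP cmin exL} c [c0 /perP cP cmin]; split => // z.
pose I z := forall n, M (n + z) <-> M n.
have IB x y : I x -> I y -> I (x - y).
  by move=> Ix Iy n; rewrite -(Ix n) -(Iy (n + (x - y))) addrA subrK.
have I0 : I 0 by move=> n; rewrite addr0.
have IN x : I x -> I (- x) by rewrite -[- x]sub0r; exact: IB.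
have ID x y : I x -> I y -> I (x + y) by move=> Ix Iy; rewrite -[y]opprK; exact/IB/IN.
have Imul (k : int) : I (k * c%:Z).
  elim/int_rec: k => [|k IH|k IH]; first by rewrite mul0r.
    by rewrite -addn1 PoszD mulrDl mul1r; exact: ID.
  by rewrite -addn1 PoszD opprD mulrDl mulN1r; exact: IB.
split=> [Iz|/dvdzP[k ->]]; last exact: Imul.
have c'0 : c%:Z != 0 by lia.
have Ir : I (z %% c%:Z)%Z by rewrite /modz; exact: IB.
have := modz_ge0 z c'0; have := @ltz_pmod z c%:Z; rewrite ltz_nat => /(_ c0).
move=> rc r_ge0; apply/dvdz_mod0P; case: (z %% c%:Z)%Z Ir rc r_ge0 => // r Ir rc _.
case: (posnP r) => [->//|r0].
by have := cmin r r0 (iffRL (perP _) Ir); lia.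
Qed.

Lemma stabP (G : zmodType) (A : set G) h : stab A h <-> forall a, A (a + h) <-> A a.
Proof.
rewrite /stab /=; split=> [Ah a|Ah].
  split=> [|Aa]; last by rewrite -Ah; exists a.
  by rewrite -{1}Ah => -[b Ab /addIr <-].
rewrite eqEsubset; split=> [_ [a Aa <-]|a Aa]; first exact/Ah.
by exists (a - h); [apply/Ah; rewrite subrK|rewrite subrK].
Qed.

Lemma residue_valB m n (u v : cyc n) : (0 < m)%N -> (0 < n)%N -> (m %| n)%N ->
  residue m ((u - v)%R : nat)%:Z = residue m (u : nat)%:Z - residue m (v : nat)%:Z.
Proof.
move=> m0 n0 mn; rewrite -{1}[u]residue_nat -{1}[v]residue_nat -!residueB.
exact: residue_residue.
Qed.

(** * Cores and the arithmetic of the sequences s, c and d *)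

Section BFree.
Variables (B : set nat) (S : nat -> {fset nat}).
Hypotheses (B_gt0 : forall b, B b -> (0 < b)%N)
  (S_incr : forall k, (S k `<=` S k.+1)%fset) (S_cover : \bigcup_k [set` S k] = B).

Local Notation s := (s_ S).
Local Notation c := (c_ B S).
Local Notation d := (d_ B S).
Local Notation X := (subshift (eta_free B)).
Local Notation sigma := (@left_shift (eta_free B)).
Local Notation G := (cycprod (fun b : B => val b)).

(* As n + s_k Z meets bZ iff gcd(b, s_k) divides n, the integer n is in core k
   iff the whole class n + s_k Z is B-free. *)
Definition core (k : nat) : set int := free_set (gcd_set B (S k)).

Lemma S_sub k b : b \in S k -> B b.
Proof. by move=> bS; rewrite -S_cover; exists k. Qed.

Lemma S_mono k l : (k <= l)%N -> (S k `<=` S l)%fset.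
Proof. by move=> /subnK <-; elim: (l - k)%N => // j IH; exact: fsubset_trans IH (S_incr _). Qed.

Lemma S_coverP b : B b -> exists k, b \in S k.
Proof. by rewrite -S_cover => -[k _]; exists k. Qed.

Lemma s_gt0 k : (0 < s k)%N.
Proof. by apply: lcm_fset_gt0 => b /S_sub/B_gt0. Qed.

Lemma s_dvd k l : (k <= l)%N -> (s k %| s l)%N.
Proof.
by move=> kl; apply: lcm_fset_dvdn => b /(fsubsetP (S_mono kl)); exact: dvdn_lcm_fset.
Qed.

Lemma dvd_s k b : b \in S k -> (b %| s k)%N.
Proof. exact: dvdn_lcm_fset. Qed.

Lemma coreP k n : core k n <-> forall j : int, free_set B (n + (s k)%:Z * j).
Proof.
split=> [nk j [b Bb bn]|nk [_ [b Bb <-] /dvdz_shift[j bn]]].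
  by apply: nk; exists (gcdn b (s k)); [exists b|apply/dvdz_shift; exists j].
by apply: (nk j); exists b.
Qed.

Lemma core_le k l n : (k <= l)%N -> core k n <-> forall j : int, core l (n + (s k)%:Z * j).
Proof.
move=> /s_dvd/dvdnP[t st]; split=> [/coreP nk j|nk].
  by apply/coreP => i; rewrite st PoszM -addrA [_ * _%:Z]mulrC -mulrA -mulrDr; exact: nk.
by apply/coreP => j; have /coreP/(_ 0) := nk j; rewrite mulr0 addr0.
Qed.

Lemma core_sub k l n : (k <= l)%N -> core k n -> core l n.
Proof. by move=> kl /(core_le _ kl)/(_ 0); rewrite mulr0 addr0. Qed.

Lemma core_mod_s k n (j : int) : core k (n + (s k)%:Z * j) <-> core k n.
Proof.
split=> [nk|nk]; last exact: (iffLR (core_le _ (leqnn k))).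
have := iffLR (core_le _ (leqnn k)) nk (- j).
by rewrite mulrN addrK.
Qed.

Lemma c_periodP k z : (forall n, core k (n + z) <-> core k n) <-> ((c k)%:Z %| z)%Z.
Proof.
(* [c] is defined through the multiples, [core] through their complement; both sets have the same
   periods. *)
have notE y : (forall n, core k (n + y) <-> core k n) <->
    (forall n, multiples (gcd_set B (S k)) (n + y) <-> multiples (gcd_set B (S k)) n).
  split=> E n; last by split => nk /E.
  by split=> nk; apply: contrapT => /E.
have per_s n : core k (n + (s k)%:Z) <-> core k n.
  by have := core_mod_s k n 1; rewrite mulr1.
have [_ cP] := least_periodP (s_gt0 k) (iffLR (notE _) per_s).
by rewrite notE.
Qed.

Lemma core_shift k n z : ((c k)%:Z %| z)%Z -> core k (n + z) <-> core k n.
Proof. by move=> /c_periodP. Qed.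

Lemma core_congr k n n' : ((c k)%:Z %| n - n')%Z -> core k n <-> core k n'.
Proof. by move=> cn; have := core_shift n' cn; rewrite addrC subrK. Qed.

Lemma c_dvd_s k : (c k %| s k)%N.
Proof.
suff : ((c k)%:Z %| (s k)%:Z)%Z by rewrite dvdzE.
by apply/c_periodP => n; rewrite -[(s_ _ _)%:Z]mulr1; exact: core_mod_s.
Qed.

(** By [core_le], the core of level [k] is defined from that of level [l] in a translation invariant
    way, so it inherits the periods of the latter. *)
Lemma c_dvd k l : (k <= l)%N -> (c k %| c l)%N.
Proof.
move=> kl; suff : ((c k)%:Z %| (c l)%:Z)%Z by rewrite dvdzE.
apply/c_periodP => n; rewrite !(core_le _ kl).
have E j : core l (n + (c l)%:Z + (s k)%:Z * j) <-> core l (n + (s k)%:Z * j).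
  by rewrite addrAC; apply: core_shift; exact: dvdzz.
by split=> nk j; apply/E.
Qed.

(** The numbers gcd(s_k, c_l) increase with [l] for divisibility and are bounded by s_k, so they are
    constant from the place where their maximum is reached. *)
Lemma d_eventually k : exists N, forall l, (N <= l)%N -> gcdn (s k) (c l) = d k.
Proof.
pose g j := gcdn (s k) (c j).
have gs j : (g j <= s k)%N by apply: dvdn_leq; [exact: s_gt0|exact: dvdn_gcdl].
have exg : exists m, `[< exists j, g j = m >] by exists (g 0); apply/asboolP; exists 0.
have ubg m : `[< exists j, g j = m >] -> (m <= s k)%N by move=> /asboolP[j <-].
have [m /asboolP[N gN] gmax] := ex_maxnP exg ubg.
have gE l : (N <= l)%N -> g l = m.
  move=> Nl; apply/eqP; rewrite eqn_leq gmax; last by apply/asboolP; exists l.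
  rewrite -gN dvdn_leq ?gcdn_gt0 ?s_gt0// dvdn_gcd dvdn_gcdl /=.
  exact: dvdn_trans (dvdn_gcdr _ _) (c_dvd Nl).
exists N => l Nl; rewrite -/(g l) gE //; apply/esym/cvg_lim; first exact: discrete_hausdorff.
(* The sequence in [d_] starts at c_k; its index [k + j] is beyond [N] as soon as [j] is. *)
apply: cvg_near_cst; exists N => // j /= Nj; apply: gE.
exact: leq_trans Nj (leq_addl _ _).
Qed.

Lemma gcd_dvd_d k l : (gcdn (s k) (c l) %| d k)%N.
Proof.
have [N /(_ (maxn N l)) <-] := d_eventually k; last exact: leq_maxl.
by rewrite dvdn_gcd dvdn_gcdl (dvdn_trans (dvdn_gcdr _ _)) // c_dvd // leq_maxr.
Qed.

(** Together with [c_dvd_d], this makes the sequences c and d cofinal for divisibility: divisibility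
    by all c_k or by all d_k is the same condition. *)
Lemma d_dvd_c k : exists l, (d k %| c l)%N.
Proof. by have [N /(_ N (leqnn N)) <-] := d_eventually k; exists N; exact: dvdn_gcdr. Qed.

Lemma d_dvd_s k : (d k %| s k)%N.
Proof. by have [N /(_ N (leqnn N)) <-] := d_eventually k; exact: dvdn_gcdl. Qed.

Lemma d_gt0 k : (0 < d k)%N.
Proof. exact: dvdn_gt0 (s_gt0 k) (d_dvd_s k). Qed.

Lemma c_dvd_d k : (c k %| d k)%N.
Proof. by apply: dvdn_trans (gcd_dvd_d k k); rewrite dvdn_gcd c_dvd_s dvdnn. Qed.

Lemma d_dvd k : (d k %| d k.+1)%N.
Proof.
have [l dc] := d_dvd_c k; apply: dvdn_trans (gcd_dvd_d k.+1 l).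
by rewrite dvdn_gcd dc (dvdn_trans (d_dvd_s k)) // s_dvd.
Qed.

Lemma dvdz_le (m n : nat) z : (m %| n)%N -> (n%:Z %| z)%Z -> (m%:Z %| z)%Z.
Proof. by move=> mn; apply: dvdz_trans. Qed.

(* There are finitely many classes modulo s_l, so one level L serves them all. *)
Lemma noncore_witness l : exists2 L, (l <= L)%N & forall n, ~ core l n ->
  exists j : int, exists2 b, b \in S L & (b%:Z %| n + (s l)%:Z * j)%Z.
Proof.
have wit (r : 'I_(s l)) : exists K, ~ core l (r : nat)%:Z ->
    exists j : int, exists2 b, b \in S K & (b%:Z %| (r : nat)%:Z + (s l)%:Z * j)%Z.
  have [rl|nrl] := pselect (core l (r : nat)%:Z); first by exists 0.
  have [j] : exists j : int, ~ free_set B ((r : nat)%:Z + (s l)%:Z * j).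
    by apply/existsNP => /coreP.
  move=> /contrapT[b /S_coverP[K bK] bn]; by exists K => _; exists j; exists b.
have [K KP] := choice wit.
exists (maxn l (\max_(r < s l) K r)); first exact: leq_maxl.
move=> n; have s0 := s_gt0 l; have s1 : (s l)%:Z != 0 by lia.
have := divz_eq n (s l)%:Z; have := modz_ge0 n s1.
have := @ltz_pmod n (s l)%:Z; rewrite ltz_nat => /(_ s0).
move: (n %/ _)%Z (n %% _)%Z => q [r|r] rs // _ ->.
rewrite addrC mulrC core_mod_s => /(KP (Ordinal rs))[j [b bK bn]].
(* Here [n = r + s_l q], so the shift found for the remainder [r] is corrected by [q]. *)
exists (j - q); exists b; last by rewrite mulrBr addrA [_ + _ * q + _]addrAC addrK.
apply: fsubsetP bK; apply: S_mono; apply: leq_trans (leq_maxr _ _).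
exact: (leq_bigmax (Ordinal rs)).
Qed.

(** * Addresses of points of the orbit closure *)

(* Intended for x in the orbit closure of eta: it is what survives in the limit
   when x is approximated by sigma^m eta with m = n modulo s_L. *)
Definition address (L : nat) (n : int) (x : {ptws int -> bool}) : Prop := forall k,
  (core L (k + n) -> x k) /\ ((exists2 b, b \in S L & (b%:Z %| k + n)%Z) -> ~~ x k).

Lemma address_translate L n : address L n (translate n (eta_free B)).
Proof.
move=> k; split=> [/(core_sub (leqnn L)) kn|[b bL bkn]].
  by apply/mem_set; have /coreP/(_ 0) := kn; rewrite mulr0 addr0.
apply/negP => /set_mem; apply; exists b => //.
exact: (S_sub bL).
Qed.

Lemma address_congr L n n' x : ((s L)%:Z %| n' - n)%Z -> address L n x -> address L n' x.
Proof.
move=> /dvdzP[j nE] nx k; have [x1 x0] := nx k.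
have {nE} -> : n' = n + (s L)%:Z * j by rewrite mulrC -nE addrC subrK.
rewrite addrA; split=> [/core_mod_s|[b bL bn]]; first exact: x1.
apply: x0; exists b => //; rewrite -[k + n](addrK ((s L)%:Z * j)).
by apply: rpredB => //; apply: dvdz_mulr; rewrite dvdzE; exact: dvd_s.
Qed.

Lemma address_le L L' n x : (L <= L')%N -> address L' n x -> address L n x.
Proof.
move=> LL' nx k; have [x1 x0] := nx k; split=> [/(core_sub LL') //|[b bL bn]].
by apply: x0; exists b => //; exact: (fsubsetP (S_mono LL')).
Qed.

Lemma address_shift L n x : address L n x -> address L (n + 1) (translate 1 x).
Proof. by move=> nx k; have := nx (k + 1); rewrite /translate addrAC addrA. Qed.

Lemma ptws_coord_nbhs (x : {ptws int -> bool}) (k : int) :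
  nbhs x [set y : {ptws int -> bool} | y k = x k].
Proof.
apply: (@proj_continuous int (fun=> bool) k x [set c | c = x k]).
by apply: open_nbhs_nbhs; split => //; exact: discrete_open.
Qed.

Lemma address_closed L n : closed (address L n).
Proof. by move=> x xC k; have [y [/(_ k) yk /= <-]] := xC _ (ptws_coord_nbhs x k). Qed.

(** Every translate of eta has one of the finitely many addresses modulo s_L, and a finite union of
    closed sets contains the closure of its subsets. *)
Lemma address_exists L x : orbit_closure (eta_free B) x ->
  exists r : 'I_(s L), address L (r : nat)%:Z x.
Proof.
have s0 := s_gt0 L; have s1 : (s L)%:Z != 0 by lia.
pose A := \bigcup_(r in [set: 'I_(s L)]) address L (r : nat)%:Z.
have cA : closed A.
  by apply: closed_bigcup => [|r _]; [exact: finite_finset|exact: address_closed].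
suff orbA : range (fun n => translate n (eta_free B)) `<=` A.
  by move=> /(closure_subset orbA)/cA[r _ rx]; exists r.
move=> _ [n _ <-]; have := modz_ge0 n s1.
have := @ltz_pmod n (s L)%:Z; rewrite ltz_nat => /(_ s0).
case nr : (n %% _)%Z => [r|//] rs _; exists (Ordinal rs) => //=.
apply: address_congr (address_translate L n).
by rewrite -nr /modz addrAC subrr add0r rpredN dvdz_mull.
Qed.

(** Positions in the core carry ones along the whole progression. For the others, [noncore_witness]
    supplies an element of [S L] that forces a zero on the progression, which is why a level [L]
    above [l] is taken. *)
Lemma core_address l : exists2 L, (l <= L)%N & forall x n, address L n x -> forall k,
  core l (k + n) <-> forall j : int, x (k + (s l)%:Z * j).
Proof.
have [L lL Lwit] := noncore_witness l; exists L => // x n nx k.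
split=> [kn j|xk].
  by apply: (nx _).1; rewrite addrAC; apply/(core_sub lL)/core_mod_s.
apply: contrapT => /Lwit[j [b bL bn]].
by have := (nx (k + (s l)%:Z * j)).2; rewrite xk addrAC => /(_ (ex_intro2 _ _ b bL bn)).
Qed.

(** By [core_address], the set of [k] with [k + n] in the core of level [l] depends on [x] alone, so
    [n - n'] is a period of that core. *)
Lemma address_unique l : exists2 L, (l <= L)%N & forall x n n',
  address L n x -> address L n' x -> ((c l)%:Z %| n - n')%Z.
Proof.
have [L lL LP] := core_address l; exists L => // x n n' nx n'x.
apply/c_periodP => m.
have -> : m + (n - n') = (m - n') + n by ring.
by rewrite (LP x n nx) -(LP x n' n'x) subrK.
Qed.

(** * The subshift and its factor map onto the inverse limit of the Z/d_k *)

Lemma iter_left_shift (x : X) m k : val (iter m sigma x) k = val x (k + m%:Z).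
Proof.
elim: m k => [|m IH] k /=; first by rewrite addr0.
by rewrite /translate IH -addrA -PoszD add1n.
Qed.

Lemma subshift_address_small L (x : X) : exists r : 'I_(s L), address L (r : nat)%:Z (val x).
Proof. exact: address_exists (set_mem (valP x)). Qed.

Lemma subshift_address L (x : X) : exists n, address L n (val x).
Proof. by have [r rx] := subshift_address_small L x; exists (r : nat)%:Z. Qed.

Lemma subshift_compact : compact [set: X].
Proof.
apply: initial_compact.
have -> : range (set_val : X -> {ptws int -> bool}) = orbit_closure (eta_free B).
  rewrite eqEsubset; split => [_ [x _ <-]|x ox]; first exact: set_mem (valP x).
  by exists (exist _ x (mem_set ox)).
apply: (@subclosed_compact _ _ setT) => //; first exact: closed_closure.
have fin : finite_set [set: bool] by exact: finite_finset.
have := @tychonoff int (fun=> bool) (fun=> setT) (fun=> finite_compact fin).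
by congr compact; rewrite eqEsubset.
Qed.

Lemma subshift_coord_nbhs (x : X) (k : int) : nbhs x [set y : X | val y k = val x k].
Proof.
have cval := @initial_continuous _ _ (set_val : X -> {ptws int -> bool}) x.
exact: cval _ (ptws_coord_nbhs (val x) k).
Qed.

(** Describes the factor map independently of the addresses chosen to construct it. The threshold
    [L0] is uniform in [x], which yields continuity. *)
Definition reads_address (p : X -> invlim d) := forall k, exists L0, forall L, (L0 <= L)%N ->
  forall x n, address L n (val x) -> val (p x) k = residue (d k) n.

(** As d_k divides some c_l, [address_unique] makes the class modulo d_k of a high-level address
    independent of the address. *)
Lemma factor_exists : exists p, reads_address p.
Proof.
have lev k : exists L0, forall L x n n', (L0 <= L)%N ->
    address L0 n x -> address L n' x -> ((d k)%:Z %| n - n')%Z.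
  have [l dc] := d_dvd_c k.
  have [L0 _ L0P] := address_unique l.
  exists L0 => L x n n' LL nx /(address_le LL) n'x.
  exact: dvdz_le dc (L0P _ _ _ nx n'x).
have [L0 L0P] := choice lev.
have [a aP] := choice (fun xk : X * nat =>
  subshift_address (L0 xk.2) xk.1).
pose f (x : X) : cycprod d := fun k => residue (d k) (a (x, k)).
have fP k L x n : (L0 k <= L)%N -> address L n (val x) -> f x k = residue (d k) n.
  move=> LL nx; apply/residueP; first exact: d_gt0 k.
  exact: L0P LL (aP (x, k)) nx.
have f_inv x : f x \in @invlim_pred d.
  apply/asboolP => k.
  (* A single address of high level represents both neighbouring coordinates, which is the condition
     for a thread. *)
  have [n nx] := subshift_address (maxn (L0 k) (L0 k.+1)) x.
  by exists n; split; apply: fP nx; rewrite ?leq_maxl ?leq_maxr.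
exists (fun x => in_zsub (f_inv x)) => k; exists (L0 k) => L LL x n nx.
exact: fP LL nx.
Qed.

Lemma reads_address_orbit p n (x : X) : reads_address p -> val x = translate n (eta_free B) ->
  p x = invlim_int d n.
Proof.
move=> pP xn; apply/val_inj/functional_extensionality_dep => k.
have [L /(_ L (leqnn L)) LP] := pP k; apply: LP; rewrite xn.
exact: address_translate.
Qed.

(** For each coordinate, the preimage of any set is a finite union of closed sets of points with a
    given address. *)
Lemma reads_address_continuous p : reads_address p -> continuous p.
Proof.
move=> pP; apply: zsub_continuous => k; apply/continuous_closedP => A _.
have [L /(_ L (leqnn L)) LP] := pP k.
have s0 := s_gt0 L.
have -> : (fun x => val (p x) k) @^-1` A =
    \bigcup_(r in [set r : 'I_(s L) | A (residue (d k) (r : nat)%:Z)])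
      (val @^-1` address L (r : nat)%:Z).
  rewrite eqEsubset; split => [x /= Ax|x [r /= Ar /LP /= xr]]; last by rewrite xr.
  have [r rx] := subshift_address_small L x.
  by exists r => //=; rewrite -(LP _ _ rx).
apply: closed_bigcup => [|r _]; first exact: finite_finset.
move: (@address_closed L (r : nat)%:Z); apply: (iffLR (continuous_closedP _)).
exact: initial_continuous.
Qed.

(** Surjectivity holds because the translates of eta are sent to all constant threads; equivariance
    because shifting a point adds 1 to its addresses. *)
Lemma reads_address_factor p : reads_address p ->
  factor_map sigma (fun x => x + invlim_int d 1) p.
Proof.
move=> pP; have cp := reads_address_continuous pP.
split => // [|x].
  apply: invlim_surjective => // [k|k||n].
  - exact: d_gt0 k.
  - exact: d_dvd k.
  - exact: subshift_compact.
  have On : orbit_closure (eta_free B) (translate n (eta_free B)).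
    by apply: subset_closure; exists n.
  exists (exist _ (translate n (eta_free B)) (mem_set On) : X); exact: reads_address_orbit.
apply/val_inj/functional_extensionality_dep => k.
have [L /(_ L (leqnn L)) LP] := pP k.
have [n nx] := subshift_address L x.
have -> : val (p x + invlim_int d 1) k = val (p x) k + residue (d k) 1 by [].
rewrite (LP _ _ nx) -residueD; apply: LP.
exact: address_shift.
Qed.

(** * Points with the same image are proximal *)

(** Addresses congruent modulo c_l place the core of level [l] at the same positions in [x] and [y].
    They are required at every high level [L], since the decided zeros depend on [S L]. *)
Definition same_cores (x y : {ptws int -> bool}) := forall l, exists L0, forall L, (L0 <= L)%N ->
  exists n n', [/\ address L n x, address L n' y & ((c l)%:Z %| n - n')%Z].

Lemma reads_address_same_cores p (x y : X) : reads_address p -> p x = p y ->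
  same_cores (val x) (val y).
Proof.
move=> pP pxy l; have [L0 L0P] := pP l; exists L0 => L LL.
have [n nx] := subshift_address L x.
have [n' n'y] := subshift_address L y.
exists n, n'; split => //.
apply: (dvdz_le (c_dvd_d l)).
apply/residueP; first exact: d_gt0 l.
by rewrite -(L0P L LL _ _ nx) -(L0P L LL _ _ n'y) pxy.
Qed.

(* If the core leaves k + a undecided, a zero of x can be forced on a finer
   progression; y has the same cores, so k stays undecided for y there, and a
   further refinement forces a zero of y as well. *)
Lemma same_cores_step x y (k a : int) l : same_cores x y -> exists a' l',
  [/\ (l <= l')%N, ((s l)%:Z %| a' - a)%Z &
      forall t : int, x (k + (a' + (s l')%:Z * t)) = y (k + (a' + (s l')%:Z * t))].
Proof.
move=> xy.
(* Since [b] divides s_L, a forced zero recurs along the whole progression of step s_L. *)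
have zero L n z k' : address L n z -> (exists2 b, b \in S L & (b%:Z %| k' + n)%Z) ->
    forall t : int, z (k' + (s L)%:Z * t) = false.
  move=> nz [b bL bk] t; apply/negbTE/((nz _).2); exists b => //.
  rewrite addrAC; apply: rpredD => //; apply: dvdz_mulr.
  by rewrite dvdzE; exact: dvd_s.
have [L1 lL1 wit1] := noncore_witness l.
have [L0 L0P] := xy l; set L := maxn L0 L1.
have [n [n' [nx n'y nn']]] := L0P L (leq_maxl _ _).
have lL : (l <= L)%N := leq_trans lL1 (leq_maxr _ _).
have [kn|kn] := pselect (core l (k + a + n)).
  exists a, l; split => // [|t]; first by rewrite subrr dvdz0.
  have kn' : core l (k + a + n').
    apply: (iffLR (core_congr _)) kn.
    by rewrite (_ : _ - _ = n - n') //; ring.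
  have core_t m : core l (k + a + m) -> core L (k + (a + (s l)%:Z * t) + m).
    move=> km; have -> : k + (a + (s l)%:Z * t) + m = k + a + m + (s l)%:Z * t by ring.
    exact/(core_sub lL)/core_mod_s.
  by rewrite ((nx _).1 (core_t _ kn)) ((n'y _).1 (core_t _ kn')).
have [j [b bL1 bn]] := wit1 _ kn.
pose a1 := a + (s l)%:Z * j.
have x0 t : x (k + a1 + (s L)%:Z * t) = false.
  apply: (zero L n) => //; exists b; first exact: (fsubsetP (S_mono (leq_maxr L0 L1))).
  by have -> : k + a1 + n = k + a + n + (s l)%:Z * j by rewrite /a1; ring.
have [L2 LL2 wit2] := noncore_witness L.
have [L3 L3P] := xy L; set M := maxn L3 L2.
have [m [m' [mx m'y mm']]] := L3P M (leq_maxl _ _).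
have LM : (L <= M)%N := leq_trans LL2 (leq_maxr _ _).
(* If this position were in the core for [y], it would be in the core for [x], as [m] and [m'] are
   congruent modulo c_L; then [x] would be one there, against [x0]. *)
have nk : ~ core L (k + a1 + m').
  have E : ((c L)%:Z %| (k + a1 + m) - (k + a1 + m'))%Z.
    by rewrite (_ : _ - _ = m - m') //; ring.
  move=> /(core_congr E)/(core_sub LM)/((mx _).1).
  by have := x0 0; rewrite mulr0 addr0 => ->.
have [i [b' b'L2 b'n]] := wit2 _ nk.
exists (a1 + (s L)%:Z * i), M; split.
- exact: leq_trans lL LM.
- have -> : a1 + (s L)%:Z * i - a = (s l)%:Z * j + (s L)%:Z * i by rewrite /a1; ring.
  apply: rpredD; first exact/dvdz_mulr/dvdzz.
  by apply: dvdz_mulr; rewrite dvdzE; exact: s_dvd.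
move=> t; have /dvdnP[u uE] := s_dvd LM.
have -> : x (k + (a1 + (s L)%:Z * i + (s M)%:Z * t)) = false.
  have -> : k + (a1 + (s L)%:Z * i + (s M)%:Z * t) =
      k + a1 + (s L)%:Z * (i + u%:Z * t) by rewrite uE PoszM; ring.
  exact: x0.
apply/esym; rewrite addrA; apply: (zero M m') => //; exists b'.
  exact: (fsubsetP (S_mono (leq_maxr L3 L2))).
by have -> : k + (a1 + (s L)%:Z * i) + m' = k + a1 + m' + (s L)%:Z * i by ring.
Qed.

(** One position of [F] is treated at a time; each new progression lies inside the previous one, so
    earlier agreements persist. *)
Lemma same_cores_window x y (F : seq int) : same_cores x y ->
  exists a l, forall t k : int, k \in F -> x (k + (a + (s l)%:Z * t)) = y (k + (a + (s l)%:Z * t)).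
Proof.
move=> xy; elim: F => [|k F [a [l IH]]]; first by exists 0, 0%N.
have [a' [l' [ll' aa' kP]]] := same_cores_step k a l xy.
exists a', l' => t k'; rewrite inE => /predU1P[->|k'F]; first exact: kP.
have /dvdzP[j jE] := aa'; have /dvdnP[u uE] := s_dvd ll'.
have -> : a' + (s l')%:Z * t = a + (s l)%:Z * (j + u%:Z * t).
  have -> : a' = a + j * (s l)%:Z by rewrite -jE; ring.
  by rewrite uE PoszM; ring.
exact: IH.
Qed.

Lemma same_cores_proximal x y (F : seq int) : same_cores x y ->
  exists m : nat, forall k, k \in F -> x (k + m%:Z) = y (k + m%:Z).
Proof.
move=> /(same_cores_window F)[a [l al]].
have s0 := s_gt0 l.
(* The choice [t = |a|] gives a nonnegative shift because s_l is at least 1; only iterates of the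
   shift are then involved. *)
have : 0 <= a + (s l)%:Z * `|a|%:Z by nia.
case E : (a + _) => [m|//] _; exists m => k kF.
by rewrite -E; exact: al.
Qed.

(** The windows [F N] run from [-N] to [N - 1] and exhaust the integers. Shifting by [m N] makes
    both points agree on [F N], so their limits along an ultrafilter coincide and
    [proximal_equicontinuous] applies. *)
Lemma same_cores_factor (x y : X) (Z : puniformType) (Q : Z -> Z) (q : X -> Z) :
  same_cores (val x) (val y) -> equicontinuous_system Q -> factor_map sigma Q q -> q x = q y.
Proof.
move=> xy eQ fq.
pose F N := [seq Posz i | i <- iota 0 N] ++ [seq Negz i | i <- iota 0 N].
have [m mP] := choice (fun N => same_cores_proximal (F N) xy).
have [U [UU ooU]] := @ultraFilterLemma nat \oo _.
have PU : ProperFilter U by exact: ultra_proper.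
have [w xw] := ultra_cvg (fun N => iter (m N) sigma x) UU subshift_compact.
have [w' yw'] := ultra_cvg (fun N => iter (m N) sigma y) UU subshift_compact.
suff ww' : w = w'.
  by apply: (proximal_equicontinuous PU xw _ eQ fq); rewrite ww'.
apply/val_inj/functional_extensionality_dep => k.
have UF : U [set N | k \in F N].
  apply: ooU; exists `|k|.+1 => // N /= kN; rewrite mem_cat; apply/orP.
  by case: k kN => i /= iN; [left|right]; apply/mapP; exists i => //; rewrite mem_iota; lia.
have Ux : U [set N | val (iter (m N) sigma x) k = val w k].
  exact: xw (subshift_coord_nbhs w k).
have Uy : U [set N | val (iter (m N) sigma y) k = val w' k].
  exact: yw' (subshift_coord_nbhs w' k).
have [N [/= kF [<- <-]]] := filter_ex (filterI UF (filterI Ux Uy)).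
by rewrite !iter_left_shift; exact: mP.
Qed.

(** * Maximality of the factor *)

(** Any equicontinuous factor [q] is constant on the fibres of [p], hence equals [r] after [p],
    where [r] is [q] composed with a set-theoretic section of [p]; compactness makes [r]
    continuous. *)
Lemma MEF_invlim_d : is_MEF sigma (fun x : invlim d => x + invlim_int d 1).
Proof.
have d0 := d_gt0.
split.
  split; last by move=> x E; apply: translation_equicontinuous; exact: entourage_shift.
  split; [exact: invlim_compact|exact: zsub_hausdorff|].
  by apply: translation_homeomorphism; exact: entourage_shift.
have [p pP] := factor_exists; have fp := reads_address_factor pP.
exists p; split => // Z Q q eQ fq; have [cp sp pS] := fp; have [cq sq qS] := fq.
have [g gP] := choice sp.
have qg x : q x = q (g (p x)).
  apply: same_cores_factor eQ fq; apply: reads_address_same_cores pP _.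
  by rewrite gP.
exists (q \o g); split => //; split.
- exact: (factor_continuous subshift_compact (@zsub_hausdorff _ _ _) cp sp cq qg).
- by move=> z; have [x xz] := sq z; exists (p x); rewrite /= -qg.
- by move=> z /=; rewrite -{1}[z]gP -pS -qg qS.
Qed.

(** * Cylinders of H, the interior of the window and its stabilizer *)

Lemma elt_in (b : B) : B (val b). Proof. exact: set_mem (valP b). Qed.

Lemma elt_gt0 (b : B) : (0 < val b)%N.
Proof. exact/B_gt0/elt_in. Qed.

Lemma elt_cover (b : B) : exists k, val b \in S k.
Proof. exact: (S_coverP (elt_in b)). Qed.

Lemma elt_dvd_s k (b : B) : val b \in S k -> (val b %| s k)%N.
Proof. exact: dvd_s. Qed.

Definition same_on (k : nat) (x y : G) := forall b : B, val b \in S k -> x b = y b.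

Lemma same_on_le k l x y : (k <= l)%N -> same_on l x y -> same_on k x y.
Proof. by move=> kl xy b bk; apply: xy; exact: (fsubsetP (S_mono kl)). Qed.

Lemma same_on_nbhs k (x : G) : nbhs x (same_on k x).
Proof.
suff cyl (F : seq nat) : nbhs x [set y : G | forall b : B, val b \in F -> x b = y b].
  exact: cyl (enum_fset (S k)).
elim: F => [|a F IH]; first by apply: filterS filterT => y _ b.
have [Ba|nBa] := pselect (B a); last first.
  apply: filterS IH => y xy b; rewrite inE => /predU1P[ba|]; last exact: xy.
  by case: nBa; rewrite -ba; exact: elt_in.
pose b0 : B := exist _ a (mem_set Ba).
have xb0 : nbhs x [set y : G | y b0 = x b0].
  apply: (@proj_continuous {classic B} (fun b => cyc (val b)) b0 x [set u | u = x b0]).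
  by rewrite /nbhs/=.
apply: filterS (filterI xb0 IH) => y [/= yb0 xy] b; rewrite inE => /predU1P[ba|]; last exact: xy.
by have -> : b = b0 by exact: val_inj.
Qed.

(** The relations implied by some [same_on k] form a filter; it contains equality of any one
    coordinate, hence every entourage. *)
Lemma nbhs_same_on (x : G) A : nbhs x A -> exists k, same_on k x `<=` A.
Proof.
move=> /nbhsP[E entE EA].
pose F := [set E : set (G * G) | exists k, forall x y, same_on k x y -> E (x, y)].
have FF : Filter F.
  split; first by exists 0%N.
  - move=> P Q [k kP] [l lQ]; exists (maxn k l) => y z yz.
    by split; [apply/kP/(same_on_le _ yz)/leq_maxl|apply/lQ/(same_on_le _ yz)/leq_maxr].
  - by move=> P Q PQ [k kP]; exists k => y z /kP/PQ.
have [b|k kE] := cycprod_filter FF _ entE.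
  by have [k bk] := elt_cover b; exists k => y z; apply.
by exists k => y xy; apply/EA/xsectionP/kE.
Qed.

Lemma H_predP (x : G) : x \in @H_pred B <-> forall k, exists n, same_on k x (@Delta B n).
Proof.
split=> [/set_mem xH k|xH].
  by have [_ [[n _ <-] xn]] := xH _ (same_on_nbhs k x); exists n.
apply/mem_set => U /nbhs_same_on[k kU]; have [n nP] := xH k.
by exists (@Delta B n); split; [exists n|exact: kU].
Qed.

(** Expresses that [h] is [n] modulo s_k, with an integer representative in place of a class. *)
Definition agrees (h : H B) k n := same_on k (val h) (@Delta B n).

Lemma agrees_exists (h : H B) k : exists n, agrees h k n.
Proof. exact: (iffLR (H_predP _) (valP h)). Qed.

Lemma agrees_le h k l n : (k <= l)%N -> agrees h l n -> agrees h k n.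
Proof. exact: same_on_le. Qed.

Lemma agreesD h h' k n n' : agrees h k n -> agrees h' k n' -> agrees (h + h') k (n + n').
Proof.
move=> hn h'n b bk; rewrite -[LHS]/(val h b + val h' b) hn // h'n //.
by rewrite /Delta /residues residueD.
Qed.

Lemma agreesB h h' k n n' : agrees h k n -> agrees h' k n' -> agrees (h - h') k (n - n').
Proof.
move=> hn h'n b bk; rewrite -[LHS]/(val h b - val h' b) hn // h'n //.
by rewrite /Delta /residues residueB.
Qed.

Lemma agrees_dvd h k n n' : agrees h k n -> agrees h k n' -> ((s k)%:Z %| n - n')%Z.
Proof.
move=> hn hn'; rewrite dvdzE; apply: lcm_fset_dvdn => b bk.
have bB : b \in B by apply/mem_set; exact: (S_sub bk).
have := hn (exist _ b bB) bk; rewrite (hn' (exist _ b bB) bk) => /esym/residueP.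
by move=> /(_ (elt_gt0 (exist _ b bB))); rewrite dvdzE.
Qed.

Lemma agrees_Delta k n n' : ((s k)%:Z %| n - n')%Z -> agrees (Delta_H B n) k n'.
Proof.
move=> nn' b bk; apply/residueP; first exact: elt_gt0.
exact: dvdz_le (elt_dvd_s bk) nn'.
Qed.

Lemma H_nbhs (h : H B) A : nbhs h A <-> exists k, forall h', same_on k (val h) (val h') -> A h'.
Proof.
split=> [|[k kA]].
  rewrite nbhsE => -[O [[V oV <-] Vh] OA].
  have [k kV] := nbhs_same_on (open_nbhs_nbhs (conj oV Vh)).
  by exists k => h' /kV /OA.
have kh : nbhs h ((val : H B -> G) @^-1` same_on k (val h)).
  by apply: initial_continuous; exact: same_on_nbhs.
by apply: filterS kh => h' /kA.
Qed.

(** A cylinder around [h] inside the window contains the images of all of [n + s_k Z], which is thus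
    B-free. Conversely, if a point of the cylinder vanishes at [b], a representative at a level
    containing [b] is a multiple of [b] in this class. *)
Lemma interior_windowP (h : H B) :
  (window B)° h <-> exists k n, core k n /\ agrees h k n.
Proof.
split=> [/H_nbhs[k kW]|[k [n [kn hn]]]].
  have [n hn] := agrees_exists h k; exists k, n; split => //.
  apply/coreP => j [b Bb bn].
  have : window B (Delta_H B (n + (s k)%:Z * j)).
    apply: kW => b' b'k; rewrite hn //; apply/esym/(@agrees_Delta k) => //.
    by rewrite addrAC subrr add0r; exact/dvdz_mulr/dvdzz.
  move=> /(_ (exist _ b (mem_set Bb))) /eqP; apply.
  by apply/residue0P => //; exact: B_gt0.
apply/H_nbhs; exists k => h' hh' b; apply/eqP => h'b0.
have {hh'} h'n : agrees h' k n by move=> b' b'k; rewrite -hh' // hn.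
have [K bK] := elt_cover b.
have [m h'm] := agrees_exists h' (maxn k K).
have /dvdzP[j mE] := agrees_dvd (agrees_le (leq_maxl k K) h'm) h'n.
have /coreP/(_ j)[] := kn; exists (val b); first exact: elt_in.
rewrite mulrC -mE addrC subrK; apply/residue0P; first exact: elt_gt0.
by have := agrees_le (leq_maxr k K) h'm bK; rewrite h'b0.
Qed.

(** Only one inclusion is assumed, so that the result applies both to [h] and to its opposite. *)
Lemma interior_stab_core h k n m : (forall a, (window B)° a -> (window B)° (a + h)) ->
  agrees h k n -> core k m -> core k (m + n).
Proof.
move=> hW hn km; apply/coreP => i [b Bb bn].
have [K bK] := S_coverP Bb.
have [n' hn'] := agrees_exists h (maxn k K).
have /dvdzP[j nE] := agrees_dvd hn (agrees_le (leq_maxl k K) hn').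
(* Since [n = n' + j s_k], translating this interior point by [h] gives the coordinate
   [m + n + s_k i] at [b], which is zero. *)
have aW : (window B)° (Delta_H B (m + (s k)%:Z * (i + j))).
  apply/interior_windowP; exists k, m; split => //; apply: agrees_Delta.
  by rewrite addrAC subrr add0r; exact/dvdz_mulr/dvdzz.
have /interior_subset/(_ (exist _ b (mem_set Bb)))/eqP := hW _ aW; apply.
have := agreesD (@agrees_Delta (maxn k K) _ _ _) (agrees_le (leqnn _) hn').
move=> /(_ (m + (s k)%:Z * (i + j)) (m + (s k)%:Z * (i + j))).
rewrite subrr dvdz0 => /(_ isT (exist _ b (mem_set Bb))) ->; last first.
  exact: (fsubsetP (S_mono (leq_maxr k K))).
apply/residue0P; first exact: B_gt0.
rewrite (_ : _ + n' = m + n + (s k)%:Z * i) //.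
by rewrite (_ : n = n' + j * (s k)%:Z); [ring|rewrite -nE; ring].
Qed.

(** By [interior_windowP], stabilizing the interior means that the representatives of [h] modulo s_k
    are periods of the core of level [k]. *)
Lemma H_intP h : H_int B h <-> forall k n, agrees h k n -> ((c k)%:Z %| n)%Z.
Proof.
have -> : H_int B h <-> forall a, (window B)° (a + h) <-> (window B)° a by exact: stabP.
split=> [hW k n hn|hc a].
  apply/c_periodP => m; split=> [km|]; last first.
    by apply: interior_stab_core hn => a aW; exact/hW.
  (* For the other implication the argument is applied to [- h], represented by [- n]. *)
  rewrite -[m](addrK n).
  apply: (@interior_stab_core (0 - h) k (- n)) km => [a aW|].
    by apply/hW; rewrite sub0r subrK.
  rewrite -[- n]sub0r; apply: agreesB hn => b bk.
  by apply/esym/residue0P; [exact: elt_gt0|exact: dvdz0].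
split=> /interior_windowP[k [m [km am]]]; apply/interior_windowP.
  have [n hn] := agrees_exists h k; exists k, (m - n); split.
    by apply/(core_shift _ (hc _ _ hn)); rewrite subrK.
  by rewrite -[a](addrK h); exact: agreesB.
have [n hn] := agrees_exists h k; exists k, (m + n); split; last exact: agreesD.
exact/(core_shift _ (hc _ _ hn)).
Qed.

(** * The isomorphisms of H and its quotient with inverse limits *)

Let s0 := s_gt0.
Let d0 := d_gt0.
Let sS k : (s k %| s k.+1)%N := s_dvd (leqnSn k).
Let ds := d_dvd_s.

(** Coordinate [b] is read at a chosen level [kap b] with [b] in that finite set; compatibility of
    the thread makes the choice immaterial. *)
Lemma phi_exists : exists phi : invlim s -> H B,
  forall x k, agrees (phi x) k (val x k : nat)%:Z.
Proof.
have [kap kapP] := choice elt_cover.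
pose f (x : invlim s) : cycprod (fun b : B => val b) :=
  fun b => residue (val b) (val x (kap b) : nat)%:Z.
have f_on x k b : val b \in S k -> f x b = residue (val b) (val x k : nat)%:Z.
  have le j l : (j <= l)%N -> val b \in S j ->
      residue (val b) (val x l : nat)%:Z = residue (val b) (val x j : nat)%:Z.
    move=> jl bj; rewrite -(invlim_coord s0 sS x jl) residue_residue //.
      exact: elt_gt0 b.
    exact: elt_dvd_s bj.
  by move=> bk; rewrite /f -(le _ _ (leq_maxl (kap b) k)) // (le _ _ (leq_maxr _ _)).
have fH x : f x \in @H_pred B.
  by apply/H_predP => k; exists (val x k : nat)%:Z => b /f_on.
by exists (fun x => in_zsub (fH x)) => x k b bk; exact: f_on.
Qed.

Lemma theta_exists : exists theta : invlim s -> invlim d,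
  forall x k, val (theta x) k = residue (d k) (val x k : nat)%:Z.
Proof.
pose f (x : invlim s) : cycprod d := fun k => residue (d k) (val x k : nat)%:Z.
have fP x : f x \in @invlim_pred d.
  apply/asboolP => k; exists (val x k.+1 : nat)%:Z; split => //.
  by rewrite /f -(invlim_coord s0 sS x (leqnSn k)) residue_residue.
by exists (fun x => in_zsub (fP x)).
Qed.

Section Phi.
Variable phi : invlim s -> H B.
Hypothesis phiP : forall x k, agrees (phi x) k (val x k : nat)%:Z.

Lemma phi_agrees x k n : agrees (phi x) k n <-> val x k = residue (s k) n.
Proof.
split=> [xn|xn]; last first.
  have := @phiP x k; rewrite xn => {}xn b bk.
  rewrite (xn b bk); apply: residue_residue => //; first exact: elt_gt0 b.
  exact: elt_dvd_s bk.
rewrite -[LHS]residue_nat; apply/residueP => //.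
exact: (agrees_dvd (@phiP x k) xn).
Qed.

Lemma same_on_eq (h h' : H B) : (forall k, same_on k (val h) (val h')) -> h = h'.
Proof.
move=> hh'; apply/val_inj/functional_extensionality_dep => b.
by have [k bk] := elt_cover b; exact: hh' bk.
Qed.

Lemma phi_additive : zmod_morphism phi.
Proof.
move=> x y; apply: same_on_eq => k b bk; rewrite (phiP _ bk).
rewrite (agreesB (@phiP x k) (@phiP y k) bk) /Delta /residues residueB.
apply: residue_valB => //; [exact: elt_gt0 b|exact: elt_dvd_s bk].
Qed.

Lemma phi_injective : injective phi.
Proof.
move=> x y xy; apply/val_inj/functional_extensionality_dep => k.
by rewrite -[RHS]residue_nat; apply/phi_agrees; rewrite xy; exact: @phiP.
Qed.

Lemma phi_surjective h : exists x, phi x = h.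
Proof.
have [n nP] := choice (agrees_exists h).
pose f : cycprod s := fun k => residue (s k) (n k).
have fP : f \in @invlim_pred s.
  apply/asboolP => k; exists (n k.+1); split => //; apply/residueP => //.
  exact: (agrees_dvd (nP k) (agrees_le (leqnSn k) (nP k.+1))).
exists (in_zsub fP); apply: same_on_eq => k b bk.
by rewrite (nP k b bk); apply: (iffRL (phi_agrees (in_zsub fP) k (n k))).
Qed.

Lemma phi_continuous : continuous phi.
Proof.
apply: zsub_continuous => b x A; have [k bk] := elt_cover b.
move=> /nbhs_singleton Ax.
have : nbhs x [set y : invlim s | val y k = val x k].
  by apply: (@zsub_coord_continuous _ _ _ k x [set u | u = val x k]); rewrite /nbhs/=.
apply: filterS => y; rewrite -[X in X -> _]/(val y k = val x k) => yx.
rewrite /= (_ : val (phi y) b = val (phi x) b) //.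
by rewrite (phiP y bk) (phiP x bk) /Delta /residues yx.
Qed.

Lemma phi_homeomorphism : homeomorphism phi.
Proof.
apply: compact_homeomorphism phi_continuous phi_injective phi_surjective.
  exact: invlim_compact.
exact: zsub_hausdorff.
Qed.

Lemma H_compact : compact [set: H B].
Proof.
have := continuous_compact (continuous_subspaceT phi_continuous) (invlim_compact s0).
by congr compact; rewrite eqEsubset; split => // h _; have [x <-] := phi_surjective h; exists x.
Qed.

Lemma H_quot_compact : compact [set: H_quot B].
Proof.
have cpi : continuous (zpi (@stab_pred _ (window B)°)) by exact: pi_continuous.
have := continuous_compact (continuous_subspaceT cpi) H_compact.
by congr compact; rewrite eqEsubset; split => // q _; have [h <-] := zpi_surj q; exists h.
Qed.

Lemma phi_int n : phi (invlim_int s n) = Delta_H B n.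
Proof. by apply: same_on_eq => k; exact: (iffRL (phi_agrees (invlim_int s n) k n)). Qed.

Lemma H_int_phi x : H_int B (phi x) <-> forall k, ((d k)%:Z %| (val x k : nat)%:Z)%Z.
Proof.
have -> : H_int B (phi x) <-> forall k, ((c k)%:Z %| (val x k : nat)%:Z)%Z.
  split=> [/H_intP hc k|xc]; first exact: hc (@phiP x k).
  apply/H_intP => k n xn.
  have := agrees_dvd xn (@phiP x k).
  move=> /(dvdz_le (c_dvd_s k)) cn.
  by rewrite -[n](subrK (val x k : nat)%:Z); apply: rpredD.
split=> xd k; last exact: dvdz_le (c_dvd_d k) (xd k).
(* For large [l], d_k divides c_l and so [val x l], while coordinates [k] and [l] of [x] agree
   modulo s_k, hence modulo d_k. *)
have [l0 dc0] := d_dvd_c k.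
pose l := maxn k l0; have kl : (k <= l)%N := leq_maxl _ _.
have dc : (d k %| c l)%N.
  by apply: dvdn_trans dc0 (c_dvd (leq_maxr k l0)).
have := invlim_coord s0 sS x kl; rewrite -[RHS]residue_nat => /residueP.
move=> /(_ (s0 k))/(dvdz_le (ds k)) xlk.
rewrite -[(val x k : nat)%:Z](subKr (val x l : nat)%:Z); apply: rpredB => //.
exact: dvdz_le dc (xd l).
Qed.

Section Psi.
Variable theta : invlim s -> invlim d.
Hypothesis thetaP : forall x k, val (theta x) k = residue (d k) (val x k : nat)%:Z.

Lemma theta_additive : zmod_morphism theta.
Proof.
move=> x y; apply/val_inj/functional_extensionality_dep => k.
by rewrite -[RHS]/(val (theta x) k - val (theta y) k) !thetaP; exact: residue_valB.
Qed.

Lemma theta_continuous : continuous theta.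
Proof.
apply: zsub_continuous => k x A /nbhs_singleton Ax.
have : nbhs x [set y : invlim s | val y k = val x k].
  by apply: (@zsub_coord_continuous _ _ _ k x [set u | u = val x k]); rewrite /nbhs/=.
apply: filterS => y; rewrite -[X in X -> _]/(val y k = val x k) => yx.
have yxk : val (theta y) k = val (theta x) k by rewrite !thetaP yx.
by rewrite /= yxk.
Qed.

Lemma theta_int n : theta (invlim_int s n) = invlim_int d n.
Proof.
apply/val_inj/functional_extensionality_dep => k; rewrite thetaP.
exact: residue_residue.
Qed.

Lemma theta_surjective y : exists x, theta x = y.
Proof.
apply: invlim_surjective (invlim_compact s0) theta_continuous _ y => //.
  exact: d_dvd.
by move=> n; exists (invlim_int s n); exact: theta_int.
Qed.

(** By [H_int_phi], the kernel of [theta] is the preimage of [H_int] under [phi]. *)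
Lemma theta_kernel x y :
  theta x = theta y <-> zpi (@stab_pred _ (window B)°) (phi x) = zpi _ (phi y).
Proof.
have -> : zpi (@stab_pred _ (window B)°) (phi x) = zpi _ (phi y) <-> H_int B (phi (x - y)).
  by rewrite phi_additive zpi_eq; split=> E; [exact: (asboolW E)|exact: (asboolT E)].
rewrite H_int_phi; split=> [xy k|xyd].
  apply/residue0P => //; rewrite -thetaP theta_additive xy subrr.
  by [].
apply/val_inj/functional_extensionality_dep => k; apply/eqP; rewrite -subr_eq0; apply/eqP.
by rewrite -[LHS]/(val (theta x - theta y) k) -theta_additive thetaP; apply/residue0P.
Qed.

(** [psi] is [theta] on representatives, well defined and injective by [theta_kernel]. It is
    continuous since its composite with the quotient map is [theta] after the inverse of [phi]. *)
Lemma psi_exists : exists psi : H_quot B -> invlim d,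
  topological_group_iso psi /\ forall x, psi (zpi _ (phi x)) = theta x.
Proof.
have lift_ex (q : H_quot B) : exists x, zpi _ (phi x) = q.
  have [h <-] := zpi_surj q; have [x <-] := phi_surjective h.
  by exists x.
have [rep repP] := choice lift_ex.
pose psi q := theta (rep q).
have psiE x : psi (zpi _ (phi x)) = theta x by apply/theta_kernel; rewrite repP.
have [_ [g [cg gK Kg]]] := phi_homeomorphism.
have cpsi : continuous psi.
  apply/quotient_continuous.
  have -> : psi \o \pi_(quotient_topology _)%qT = theta \o g.
    by apply/funext => h; rewrite /= -psiE Kg.
  by move=> h; apply: continuous_comp; [exact: cg|exact: theta_continuous].
exists psi; split => //; split.
  move=> q r; rewrite -[q in LHS]repP -[r in LHS]repP -theta_additive -psiE phi_additive.
  congr psi; apply: (addIr (zpi _ (phi (rep r)))).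
  by rewrite -zpiD subrK !repP subrK.
apply: compact_homeomorphism => //; [exact: H_quot_compact|exact: zsub_hausdorff| |].
  by move=> q r /theta_kernel; rewrite !repP.
by move=> y; have [x <-] := theta_surjective y; exists (zpi _ (phi x)).
Qed.

End Psi.

(** * Criteria for a trivial stabilizer *)

(** As gcd(s_k, c_l) divides d_k, the class of d_k modulo s_k contains a multiple [n l] of c_l for
    each [l]. A limit of these integers lies in the stabilizer and equals d_k modulo s_k; triviality
    then forces s_k to divide d_k. *)
Lemma H_int_sd : H_int B = [set 0] -> forall k, s k = d k.
Proof.
move=> H0 k.
have nex l : exists j : int, ((c l)%:Z %| (d k)%:Z + (s k)%:Z * j)%Z.
  apply/dvdz_shift; rewrite gcdnC dvdzE.
  exact: gcd_dvd_d k l.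
have [j jP] := choice nex; pose n l := (d k)%:Z + (s k)%:Z * j l.
have [U [UU ooU]] := @ultraFilterLemma nat \oo _.
have PU : ProperFilter U by exact: ultra_proper.
have [x ux] := ultra_cvg (fun l => invlim_int s (n l)) UU (invlim_compact s0).
have xk : val x k = residue (s k) (d k)%:Z.
  have [l /= <-] := filter_ex (zsub_cvg_coord ux k).
  apply/residueP => //; rewrite /n addrAC subrr add0r.
  exact/dvdz_mulr/dvdzz.
have x0 : H_int B (phi x).
  apply/H_intP => i m /phi_agrees xm.
  have iU : U [set l | (i <= l)%N] by apply: ooU; exists i.
  have [l [xl il]] := filter_ex (filterI (zsub_cvg_coord ux i) iU).
  have := etrans xl xm => /residueP-/(_ (s0 i)).
  move=> /(dvdz_le (c_dvd_s i)) nm.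
  rewrite -[m](subKr (n l)); apply: rpredB => //.
  exact: dvdz_le (c_dvd il) (jP l).
have : phi x = phi (x - x) by move: x0; rewrite H0 phi_additive subrr.
move=> /phi_injective; rewrite subrr => x0'.
have : residue (s k) (d k)%:Z = 0 by rewrite -xk x0'.
move=> /residue0P-/(_ (s0 k)); rewrite dvdzE => sd.
by apply/eqP; rewrite eqn_dvd sd ds.
Qed.

Lemma H_int_eq0 : (forall x : invlim s, (forall k, ((d k)%:Z %| (val x k : nat)%:Z)%Z) -> x = 0) ->
  H_int B = [set 0].
Proof.
have phi0 : phi 0 = 0 by have := phi_additive 0 0; rewrite !subrr.
move=> xd; rewrite eqEsubset; split=> [h|_ ->].
  by have [x <-] := phi_surjective h => /H_int_phi/xd ->.
by apply/stabP => a; rewrite addr0.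
Qed.

Lemma sd_H_int : (forall k, s k = d k) -> H_int B = [set 0].
Proof.
move=> sd; apply: H_int_eq0 => x xd; apply/val_inj/functional_extensionality_dep => k.
rewrite -[LHS]residue_nat; apply/residue0P => //.
by apply: dvdz_le (xd k); rewrite sd.
Qed.

Lemma H_int_divides : H_int B = [set 0] <-> forall b, B b -> exists n, (b %| c n)%N.
Proof.
split=> [/H_int_sd sd b Bb|bc].
  have [k bk] := S_coverP Bb; have [l dc] := d_dvd_c k.
  by exists l; apply: dvdn_trans dc; rewrite -sd; exact: dvd_s.
apply: H_int_eq0 => x /H_int_phi /H_intP xc.
apply: phi_injective; apply: same_on_eq => k b bk.
have [n bn] := bc _ (elt_in b); pose l := maxn k n.
have bl : val b \in S l by exact: (fsubsetP (S_mono (leq_maxl k n))).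
(* At level [l] both [b] is in [S l] and [b] divides c_l, which divides the coordinate of [x]. *)
rewrite (phiP x bl) (phiP 0 bl); apply/residueP; first exact: elt_gt0 b.
rewrite subr0; apply: dvdz_le (xc _ _ (@phiP x l)).
exact: dvdn_trans bn (c_dvd (leq_maxr k n)).
Qed.

End Phi.

End BFree.

(** * Transport of the factor to H and its quotient *)

Theorem theoremD (B : set nat) (S : nat -> {fset nat})
  (B_gt0 : forall b, B b -> (0 < b)%N)
  (B_infinite : infinite_set B)
  (S_increasing : forall k, (S k `<=` S k.+1)%fset)
  (S_cover : \bigcup_k [set` S k] = B) :
  exists (phi : invlim (s_ S) -> H B) (psi : H_quot B -> invlim (d_ B S)),
    [/\ topological_group_iso phi
        /\ (forall (x : invlim (s_ S)) k (b : B), val b \in S k ->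
              val (phi x) b = residue (val b) (val x k : nat)%:Z),
        [/\ topological_group_iso psi,
           (forall (x : invlim (s_ S)) k,
              val (psi (zpi _ (phi x))) k = residue (d_ B S k) (val x k : nat)%:Z)
         & psi (zpi _ (Delta_H B 1)) = invlim_int (d_ B S) 1],
        is_MEF (@left_shift (eta_free B))
          (fun q : H_quot B => q + zpi _ (Delta_H B 1))
        /\ is_MEF (@left_shift (eta_free B))
          (fun x : invlim (d_ B S) => x + invlim_int (d_ B S) 1)
      & [/\ H_int B = [set 0] <-> (forall k, s_ S k = d_ B S k),
            H_int B = [set 0] <->
              (forall b, B b -> exists n, (b %| c_ B S n)%N)
          & H_int B = [set 0] ->
            is_MEF (@left_shift (eta_free B)) (fun h : H B => h + Delta_H B 1)
            /\ is_MEF (@left_shift (eta_free B))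
              (fun x : invlim (s_ S) => x + invlim_int (s_ S) 1)]].
Proof.
have s0 := s_gt0 B_gt0 S_cover; have d0 := d_gt0 B_gt0 S_increasing S_cover.
have MEFd := MEF_invlim_d B_gt0 S_increasing S_cover.
have [phi phiP] := phi_exists B_gt0 S_increasing S_cover.
have [theta thetaP] := theta_exists B_gt0 S_increasing S_cover.
have [psi [psi_iso psiE]] := psi_exists B_gt0 S_increasing S_cover phiP thetaP.
have phi1 := phi_int B_gt0 S_cover phiP 1.
have psi1 : psi (zpi _ (Delta_H B 1)) = invlim_int (d_ B S) 1.
  by rewrite -phi1 psiE (theta_int B_gt0 S_increasing S_cover thetaP).
have phi_hom := phi_homeomorphism B_gt0 S_increasing S_cover phiP.
have phiB := phi_additive B_gt0 S_cover phiP.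
have [psiB psi_hom] := psi_iso.
have psiD x y : psi (x + y) = psi x + psi y.
  by apply/eqP; rewrite -subr_eq -psiB addrK.
have HcH := H_compact B_gt0 S_increasing S_cover phiP.
have Hsd := H_int_sd B_gt0 S_increasing S_cover phiP.
have sdH := sd_H_int B_gt0 S_increasing S_cover phiP.
have sysHq : equicontinuous_system (fun q : H_quot B => q + zpi _ (Delta_H B 1)).
  split; last first.
    by move=> x E; apply: translation_equicontinuous; exact: zquot_uniform_translations.
  split; first exact: (H_quot_compact B_gt0 S_increasing S_cover phiP).
    exact: homeomorphism_hausdorff psi_hom (@zsub_hausdorff _ _ _).
  by apply: translation_homeomorphism; exact: zquot_uniform_translations.
exists phi, psi; split.
- by split => // x k b; exact: phiP.
- by split => // x k; rewrite psiE thetaP.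
- by split => //; apply: (is_MEF_conjugate MEFd sysHq psi_hom) => q; rewrite psiD psi1.
split=> [|| H0]; [by split| exact: H_int_divides|].
have MEFs : is_MEF (@left_shift (eta_free B))
    (fun x : invlim (s_ S) => x + invlim_int (s_ S) 1).
  (* When s and d coincide as sequences, this is the result already obtained for d. *)
  by have -> : s_ S = d_ B S by apply/funext => k; exact: Hsd.
split => //; have [cphi [g [cg phiK gK]]] := phi_hom.
(* Conjugation is by the inverse [g] of [phi], from H to the inverse limit. *)
apply: (is_MEF_conjugate MEFs _ (f := g)).
- split; last by move=> x E; apply: translation_equicontinuous; exact: entourage_shift.
  split => //; first exact: zsub_hausdorff.
  by apply: translation_homeomorphism; exact: entourage_shift.
- by split => //; exists phi.
- move=> h; apply: (can_inj phiK); rewrite gK -phi1.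
  by apply/esym/eqP; rewrite -subr_eq -phiB addrK gK.
Qed.
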